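(* Let $N,k\ge1$ be integers and let $x_1,\dots,x_k$ be nonzero complex numbers with $x_i\neq x_j$ and $x_ix_j\ne1$ for $i<j$. Then $$\mathbb{E}_{g\in \mathrm{SO}(2N)}\prod_{j=1}^k\det(I+x_jg)=(x_1\cdots x_k)^N\chi^{O(2k)}_{\langle N^k\rangle}(x_1^{\pm1},\dots,x_k^{\pm1})=\sum_{\varepsilon\in\{\pm1\}^k}\ \prod_{j=1}^kx_j^{N(1-\varepsilon_j)}\prod_{1\le i<j\le k}\big(1-x_i^{\varepsilon_i}x_j^{\varepsilon_j}\big)^{-1}.$$
   Context: $\mathrm{SO}(2N)$ is the group of real orthogonal $2N\times2N$ matrices of determinant $1$, and $\mathbb{E}$ is the integral with respect to Haar probability measure. $\langle N^k\rangle$ is the partition $(N,\dots,N)$ with $k$ parts. For a partition $\lambda=(\lambda_1,\dots,\lambda_k)$ with $\lambda_k>0$, $\chi_\lambda^{O(2k)}$ is the irreducible character of the orthogonal group $O(2k)$ labelled by $\lambda$, whose value on an element of $\mathrm{SO}(2k)$ with eigenvalues $x_1^{\pm1},\dots,x_k^{\pm1}$ is the sum $\chi^{\mathrm{SO}(2k)}_{\lambda_+}+\chi^{\mathrm{SO}(2k)}_{\lambda_-}$ of the irreducible $\mathrm{SO}(2k)$-characters with highest weights $(\lambda_1,\dots,\lambda_{k-1},\pm\lambda_k)$; explicitly, as a Laurent polynomial, $$\chi^{O(2k)}_\lambda(x_1^{\pm1},\dots,x_k^{\pm1})=\frac{2\det_{1\le i,j\le k}\big(x_j^{\lambda_i+k-i}+x_j^{-(\lambda_i+k-i)}\big)}{\det_{1\le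 i,j\le k}\big(x_j^{k-i}+x_j^{-(k-i)}\big)}.$$ *)

(* Defs.v *)
From HB Require Import structures.
From mathcomp Require Import all_boot all_order all_algebra.
From mathcomp Require Import all_classical all_reals all_analysis.
From mathcomp Require Import complex.

Set Implicit Arguments.
Unset Strict Implicit.
Unset Printing Implicit Defensive.

Import Order.TTheory GRing.Theory Num.Theory.
Import numFieldNormedType.Exports.

Local Open Scope classical_set_scope.
Local Open Scope ring_scope.

Section SpecialOrthogonalGroup.
Variables (R : realType) (n : nat).

Definition SO_mx : set 'M[R]_n :=
  [set g | g^T *m g = 1%:M /\ \det g = 1].

Definition SO : Type := set_type SO_mx.

Definition mx_of_SO (g : SO) : 'M[R]_n := set_val g.

(* The subspace topology inherited from 'M[R]_n. *)
HB.instance Definition _ := Topological.copy SO (set_type SO_mx).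

Lemma SO_mx1 : SO_mx 1%:M.
Proof. by split; [rewrite trmx1 mulmx1 | exact: det1]. Qed.

Lemma SO_mxM g h : SO_mx g -> SO_mx h -> SO_mx (g *m h).
Proof.
move=> [gg dg] [hh dh]; split; last by rewrite det_mulmx dg dh mulr1.
by rewrite trmx_mul mulmxA -(mulmxA h^T) gg mulmx1.
Qed.

Lemma SO_mxV g : SO_mx g -> SO_mx g^T.
Proof. by move=> [gg dg]; split; rewrite ?det_tr// trmxK mulmx1C. Qed.

Definition SO_one : SO := exist _ 1%:M (mem_set SO_mx1).
Definition SO_mul (g h : SO) : SO :=
  exist _ (val g *m val h) (mem_set (SO_mxM (set_mem (valP g)) (set_mem (valP h)))).
Definition SO_inv (g : SO) : SO :=
  exist _ (val g)^T (mem_set (SO_mxV (set_mem (valP g)))).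

Lemma SO_mulA : associative SO_mul.
Proof. by move=> g h k; apply: val_inj; rewrite /= mulmxA. Qed.
Lemma SO_mul1 : left_id SO_one SO_mul.
Proof. by move=> g; apply: val_inj; rewrite /= mul1mx. Qed.
Lemma SO_mulr1 : right_id SO_one SO_mul.
Proof. by move=> g; apply: val_inj; rewrite /= mulmx1. Qed.
Lemma SO_mulV : left_inverse SO_one SO_inv SO_mul.
Proof. by move=> g; apply: val_inj; have [] := set_mem (valP g). Qed.
Lemma SO_mulrV : right_inverse SO_one SO_inv SO_mul.
Proof. by move=> g; apply: val_inj; have [/mulmx1C] := set_mem (valP g). Qed.

HB.instance Definition _ := isGroup.Build SO
  SO_mulA SO_mul1 SO_mulr1 SO_mulV SO_mulrV.

HB.instance Definition _ := isPointed.Build SO SO_one.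

(* The Borel sigma-algebra of the topology above. *)
HB.instance Definition _ := @isMeasurable.Build (sigma_display (@open SO)) SO
  <<s @open SO >> (@sigma_algebra0 _ setT _) (@sigma_algebraC _ _)
  (@sigma_algebra_bigcup _ setT _).

(* Left invariance; together with the total mass 1 of a [probability], this
   characterizes the Haar probability measure of the compact group SO(n). *)
Definition is_haar (mu : probability SO R) : Prop :=
  forall (h : SO) (A : set SO), measurable A ->
    mu [set (h * g)%g | g in A] = mu A.

End SpecialOrthogonalGroup.

Local Open Scope complex_scope.

(* The library integrates real-valued functions; a complex-valued one is
   integrated through its real and imaginary parts. *)
Definition cexpectation (d : measure_display) (T : measurableType d)
    (R : realType) (mu : probability T R) (F : T -> R[i]) : R[i] :=
  (\int[mu]_g complex.Re (F g)) +i* (\int[mu]_g complex.Im (F g)).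

Definition SO_cmx (R : realType) (n : nat) (g : SO R n) : 'M[R[i]]_n :=
  map_mx (real_complex R) (mx_of_SO g).

Definition rect_part (N k : nat) : seq nat := nseq k N.

(* The determinant of x_j ^ m_i + x_j ^ (- m_i), where m_i = lambda_i + k - i in
   1-based indexing; the indices below start at 0, and lambda is padded with
   zeros. *)
Definition chiO_alternant (F : fieldType) (k : nat) (lambda : seq nat)
    (x : 'I_k -> F) : F :=
  \det (\matrix_(i < k, j < k)
    let m := (nth 0 lambda i + (k - i.+1))%N in x j ^+ m + x j ^- m).

(* chi_lambda^{O(2k)} evaluated at the eigenvalues x_1^{+-1}, ..., x_k^{+-1},
   for a partition lambda with exactly k (nonzero) parts. The factor 2 is
   specific to lambda_k > 0. Up to sign, the denominator is
   2 prod_(i<j) (x_i - x_j) (1 - x_i^-1 x_j^-1), so the quotient is the Laurent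
   polynomial wherever x_i != x_j and x_i x_j != 1 for i < j. *)
Definition chiO (F : fieldType) (k : nat) (lambda : seq nat)
    (x : 'I_k -> F) : F :=
  2 * chiO_alternant lambda x / chiO_alternant [::] x.

(* A sign vector in {+-1}^k is encoded by booleans, with [true] for -1. *)
Definition sgn_of (k : nat) (e : {ffun 'I_k -> bool}) (j : 'I_k) : int :=
  (-1) ^+ e j.

(* Main.v *)
Require Import Defs.
From mathcomp Require Import all_boot all_order all_algebra all_fingroup.
From mathcomp Require Import all_classical all_reals all_analysis.
From mathcomp Require Import complex measurable_realfun.
From mathcomp Require Import ring zify.

(** Left invariance under rotations in a coordinate plane makes the Laplacian
    of SO(2N) integrate to 0 against [W g = prod_j det (x_j + g)]. Traces of the
    resolvents [x_j / (x_j + g)] turn the Laplacian of [W] into a second-order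
    operator in the [x_j]. In the variables [y_j = x_j + 1 / x_j], with
    [W = prod_j x_j ^ N phi (y_j)] and multiplied by the Weyl denominator
    [V = det (T_i (y_j))], where [T_i (x + 1 / x) = x ^ i + x ^ - i], it is the
    sum over [j] of [L = (y ^ 2 - 4) d ^ 2 + y d] in the variable [y_j], minus
    [c = sum_(i < k) (N + i) ^ 2]. Since [L T_m = m ^ 2 T_m] and
    [V prod_j phi (y_j) = det ((T_i phi) (y_j))] expands into products
    [prod_j T_(a_j) (y_j)] with [a_j < N + k] and antisymmetric coefficients,
    only those [a] with [sum_j a_j ^ 2 = c] survive the integration; as the
    [a_j] are distinct, they are the rearrangements of [N, ..., N + k - 1].
    The surviving coefficients do not depend on [g]. The sum over signs is the
    column expansion of [det (x_j ^ (N + i) + x_j ^ - (N + i))] into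
    Vandermonde determinants. *)

Set Implicit Arguments.
Unset Strict Implicit.
Unset Printing Implicit Defensive.
Import Order.TTheory GRing.Theory Num.Theory.
Import numFieldNormedType.Exports.
Local Open Scope ring_scope.

(** * Determinants *)

Section Determinants.

Lemma deriv_prod_seq (R : comNzRingType) (I : eqType) (r : seq I)
    (F : I -> {poly R}) : uniq r ->
  (\prod_(i <- r) F i)^`() =
  \sum_(a <- r) (F a)^`() * \prod_(i <- r | i != a) F i.
Proof.
elim: r => [|b r IHr] /=; first by rewrite !big_nil derivC.
case/andP=> br ur; rewrite !big_cons derivM IHr// eqxx /=; congr (_ * _ + _).
  rewrite [RHS]big_seq_cond [LHS]big_seq_cond; apply: eq_bigl => i.
  by case: (boolP (i \in r)) => //= ir; apply/esym/eqP => ib; rewrite -ib ir in br.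
rewrite mulr_sumr [RHS]big_seq [LHS]big_seq; apply: eq_bigr => a ar.
rewrite big_cons; case: eqP => [ba|_ /=]; last by rewrite mulrCA.
by rewrite ba ar in br.
Qed.

Lemma deriv_prod (R : comNzRingType) (I : finType) (F : I -> {poly R}) :
  (\prod_i F i)^`() = \sum_a (F a)^`() * \prod_(i | i != a) F i.
Proof. by rewrite deriv_prod_seq// -[index_enum I]enumT enum_uniq. Qed.

(** Jacobi's formula: by the product rule in the Leibniz expansion, the derivative is the sum over
    [a] of the determinants with row [a] differentiated, each then expanded along that row. *)
Lemma deriv_det (R : comNzRingType) (n : nat) (M : 'M[{poly R}]_n) :
  (\det M)^`() = \sum_a \sum_b (M a b)^`() * cofactor M a b.
Proof.
pose D a := \matrix_(i, j) if i == a then (M i j)^`() else M i j.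
transitivity (\sum_a \det (D a)).
  rewrite /determinant raddf_sum exchange_big /=; apply: eq_bigr => s _.
  rewrite -signr_odd; case: (odd s); rewrite ?expr1 ?expr0 ?mulN1r ?mul1r.
    rewrite derivN deriv_prod -mulr_sumr mulN1r; congr (- _).
    apply: eq_bigr => a _; rewrite [RHS](bigD1 a)//= mxE eqxx; congr (_ * _).
    by apply: eq_bigr => i /negPf ia; rewrite mxE ia.
  rewrite deriv_prod -mulr_sumr mul1r.
  apply: eq_bigr => a _; rewrite [RHS](bigD1 a)//= mxE eqxx; congr (_ * _).
  by apply: eq_bigr => i /negPf ia; rewrite mxE ia.
apply: eq_bigr => a _; rewrite (expand_det_row _ a); apply: eq_bigr => b _.
rewrite mxE eqxx; congr (_ * _); rewrite /cofactor; congr (_ * \det _).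
by apply/matrixP => i j; rewrite !mxE eq_sym (negPf (neq_lift _ _)).
Qed.

(** Sylvester's identity, from two block triangular factorisations of one matrix. It reduces the
    rank-two perturbations caused by plane rotations to 2 x 2 determinants. *)
Lemma det_addmulC (R : comPzRingType) (m n : nat) (U : 'M[R]_(m, n))
    (V : 'M[R]_(n, m)) : \det (1%:M + U *m V) = \det (1%:M + V *m U).
Proof.
have E1 : block_mx 1%:M (- U) V 1%:M =
    block_mx 1%:M 0 V 1%:M *m block_mx 1%:M (- U) 0 (1%:M + V *m U).
  by rewrite mulmx_block !(mul1mx, mulmx1, mul0mx, mulmx0, addr0) mulmxN addrCA addNr addr0.
have E2 : block_mx 1%:M (- U) V 1%:M =
    block_mx (1%:M + U *m V) (- U) 0 1%:M *m block_mx 1%:M 0 V 1%:M.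
  rewrite mulmx_block !(mul1mx, mulmx1, mul0mx, mulmx0, addr0, add0r).
  by rewrite mulNmx addrK.
have := congr1 determinant E2; rewrite {1}E1 !det_mulmx det_lblock !det_ublock.
by rewrite !det1 !mul1r !mulr1 => ->.
Qed.

Lemma det_mx2 (R : comPzRingType) (M : 'M[R]_2) :
  \det M = M 0 0 * M 1 1 - M 0 1 * M 1 0.
Proof.
rewrite (expand_det_row _ 0) !big_ord_recl big_ord0 addr0 /cofactor /=.
rewrite !det_mx11 !mxE /= expr0 mul1r expr1 mulN1r mulrN.
by congr (_ * M _ _ - M _ _ * M _ _); apply: val_inj.
Qed.

Lemma det_col_sum (R : comPzRingType) (k : nat) (J : finType)
    (f : 'I_k -> 'I_k -> J -> R) :
  \det (\matrix_(i, j) \sum_b f i j b) =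
  \sum_(e : {ffun 'I_k -> J}) \det (\matrix_(i, j) f i j (e j)).
Proof.
rewrite -det_tr.
under [RHS]eq_bigr => e _ do rewrite -det_tr.
rewrite exchange_big; apply: eq_bigr => s _ /=.
under eq_bigr => i _ do rewrite !mxE.
rewrite bigA_distr_bigA mulr_sumr; apply: eq_bigr => e _ /=.
by congr (_ * _); apply: eq_bigr => i _; rewrite !mxE.
Qed.

Lemma det_scale_cols (R : comPzRingType) (k : nat) (M : 'M[R]_k)
    (w : 'I_k -> R) :
  \det (\matrix_(i, j) (M i j * w j)) = \prod_j w j * \det M.
Proof.
have -> : \matrix_(i, j) (M i j * w j) = M *m diag_mx (\row_j w j).
  by apply/matrixP => i j; rewrite mul_mx_diag !mxE.
rewrite det_mulmx det_diag mulrC; congr (_ * _).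
by apply: eq_bigr => j _; rewrite mxE.
Qed.

Lemma det_col_expand (R : comPzRingType) (k M : nat) (c : 'I_k -> 'I_M -> R)
    (w : 'I_M -> 'I_k -> R) :
  \det (\matrix_(i, j) \sum_m c i m * w m j) =
  \sum_(a : {ffun 'I_k -> 'I_M})
    (\prod_j w (a j) j) * \det (\matrix_(i, j) c i (a j)).
Proof.
rewrite (det_col_sum (fun i j m => c i m * w m j)); apply: eq_bigr => a _.
rewrite -det_scale_cols; congr (\det _).
by apply/matrixP => i j; rewrite !mxE.
Qed.

Definition set_col (R : Type) (k : nat) (M : 'M[R]_k) (j0 : 'I_k)
  (v : 'I_k -> R) : 'M[R]_k := \matrix_(i, j) if j == j0 then v i else M i j.

Lemma det_set_col (R : comPzRingType) (k : nat) (M : 'M[R]_k) (j0 : 'I_k)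
    (v : 'I_k -> R) :
  \det (set_col M j0 v) = \sum_i v i * cofactor M i j0.
Proof.
rewrite (expand_det_col _ j0); apply: eq_bigr => i _; rewrite mxE eqxx.
congr (_ * _); rewrite /cofactor; congr (_ * \det _).
by apply/matrixP => a b; rewrite !mxE eq_sym (negPf (neq_lift _ _)).
Qed.

(** Expanding along the modified columns and exchanging the sums leaves, for each row [i], [r i]
    times the expansion of [\det M] along that row. *)
Lemma sum_det_scale_col (R : comPzRingType) (k : nat) (M : 'M[R]_k)
    (r : 'I_k -> R) :
  \sum_j \det (set_col M j (fun i => r i * M i j)) = (\sum_i r i) * \det M.
Proof.
under eq_bigr => j _ do rewrite det_set_col.
rewrite exchange_big mulr_suml; apply: eq_bigr => i _ /=.
rewrite (expand_det_row _ i) mulr_sumr.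
by apply: eq_bigr => j _; rewrite mulrA.
Qed.

Lemma det_set_col_eq (R : comPzRingType) (k : nat) (M : 'M[R]_k)
    (j0 j1 : 'I_k) : j0 != j1 -> \det (set_col M j0 (M ^~ j1)) = 0.
Proof.
move=> j01; rewrite -det_tr; apply: (determinant_alternate j01) => i.
by rewrite !mxE eqxx eq_sym (negPf j01).
Qed.

(** The matrix of values is a triangular matrix of coefficients times a Vandermonde matrix. *)
Lemma det_horner_lead (F : idomainType) (k : nat) (p : 'I_k -> {poly F})
    (y : 'I_k -> F) : (forall i, size (p i) = i.+1) ->
  \det (\matrix_(i, j) (p i).[y j]) =
  (\prod_i lead_coef (p i)) *
  \prod_(i < k) \prod_(j < k | (i < j)%N) (y j - y i).
Proof.
move=> sp; pose a := \row_j y j : 'rV[F]_k.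
have -> : \matrix_(i, j) (p i).[y j] =
    (\matrix_(i < k, m < k) (p i)`_m) *m Vandermonde k a.
  apply/matrixP => i j; rewrite !mxE (@horner_coef_wide _ k) ?sp//.
  by apply: eq_bigr => m _; rewrite !mxE.
rewrite det_mulmx det_Vandermonde det_trig.
  congr (_ * _); first by apply: eq_bigr => i _; rewrite !mxE lead_coefE sp.
  by apply: eq_bigr => i _; apply: eq_bigr => j _; rewrite !mxE.
apply/is_trig_mxP => i j ij; rewrite mxE nth_default// sp.
exact: ij.
Qed.

(** The size bound leaves a nonzero [q] no roots besides the [y j] with [j != j0], all simple; the
    sum is the logarithmic derivative at [y j0] of the resulting product of linear factors. *)
Lemma deriv_horner_roots (F : fieldType) (k : nat) (q : {poly F})
    (y : 'I_k -> F) (j0 : 'I_k) : (size q <= k)%N -> injective y ->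
    (forall j, j != j0 -> q.[y j] = 0) ->
  q^`().[y j0] = q.[y j0] * \sum_(j | j != j0) (y j0 - y j)^-1.
Proof.
move=> sq yI qy; have [->|q0] := eqVneq q 0; first by rewrite derivC !horner0 mul0r.
pose rs := [seq y j | j <- enum [pred j | j != j0]].
have urs : uniq rs by rewrite map_inj_uniq// enum_uniq.
have srs : size rs = k.-1.
  rewrite size_map -cardE; have := cardC1 j0; rewrite card_ord => <-.
  by apply: eq_card => j; rewrite !inE.
have ars : all (root q) rs.
  by apply/allP => z /mapP[j]; rewrite mem_enum inE => jj ->; apply/rootP/qy.
have sq' : size q = (size rs).+1.
  have := max_poly_roots q0 ars urs; rewrite srs => h.
  by apply/eqP; rewrite eqn_leq h andbT (leq_trans sq)// leqSpred.
have qE : q = lead_coef q *: \prod_(j | j != j0) ('X - (y j)%:P).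
  rewrite {1}(all_roots_prod_XsubC sq' ars); last by rewrite uniq_rootsE.
  by rewrite big_map big_enum; congr (_ *: _); apply: eq_bigl => j; rewrite inE.
rewrite qE derivZ !hornerZ -mulrA; congr (_ * _).
pose G j : {poly F} := if j == j0 then 1 else 'X - (y j)%:P.
have -> : \prod_(j | j != j0) ('X - (y j)%:P) = \prod_j G j.
  rewrite big_mkcond; apply: eq_bigr => j _; rewrite /G.
  by case: (j == j0).
rewrite deriv_prod horner_sum mulr_sumr [RHS]big_mkcond; apply: eq_bigr => j _.
rewrite {1}/G; case: eqP => [_|/eqP jj] /=; first by rewrite derivC mul0r horner0.
rewrite derivXsubC mul1r [in RHS](bigD1 j)//= hornerM {2}/G (negPf jj) hornerXsubC.
rewrite mulrAC divff ?mul1r//.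
by rewrite subr_eq0 (inj_eq yI) eq_sym.
Qed.

(** As a function of the point used in column [j0], the determinant is a polynomial [q] that
    vanishes at the other nodes, where two columns coincide; so [deriv_horner_roots] applies. *)
Lemma det_set_col_deriv (F : fieldType) (k : nat) (p : 'I_k -> {poly F})
    (y : 'I_k -> F) (j0 : 'I_k) : (forall i, size (p i) <= k)%N -> injective y ->
  let V := \matrix_(i, j) (p i).[y j] in
  \det (set_col V j0 (fun i => (p i)^`().[y j0])) =
  \det V * \sum_(j | j != j0) (y j0 - y j)^-1.
Proof.
move=> sp yI V; pose q := \sum_i cofactor V i j0 *: p i.
have qE z : q.[z] = \det (set_col V j0 (fun i => (p i).[z])).
  by rewrite det_set_col horner_sum; apply: eq_bigr => i _; rewrite hornerZ mulrC.
have -> : \det (set_col V j0 (fun i => (p i)^`().[y j0])) = q^`().[y j0].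
  rewrite det_set_col raddf_sum horner_sum; apply: eq_bigr => i _ /=.
  by rewrite derivZ hornerZ mulrC.
have -> : \det V = q.[y j0].
  by rewrite qE; congr (\det _); apply/matrixP => i j; rewrite !mxE; case: eqP => // ->.
apply: deriv_horner_roots => //.
  apply: (leq_trans (size_sum _ _ _)); apply/bigmax_leqP => i _.
  exact: leq_trans (size_scale_leq _ _) (sp i).
move=> j jj; rewrite qE -(@det_set_col_eq _ _ V j0 j) 1?eq_sym//.
by congr (\det _); apply/matrixP => a b; rewrite !mxE.
Qed.

End Determinants.
(** * Chebyshev polynomials *)

Section Chebyshev.

Definition tau (F : fieldType) (m : nat) (x : F) : F := x ^+ m + x ^- m.

(** The [T_m] of the overview: twice the Chebyshev polynomial of the first kind, taken at [X / 2].
    It is monic for [m > 0], while [T_0 = 2]. *)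
Fixpoint cheb (R : nzRingType) (m : nat) : {poly R} :=
  match m with
  | 0 => 2%:P
  | m'.+1 => match m' with
             | 0 => 'X
             | m''.+1 => 'X * cheb R m' - cheb R m''
             end
  end.

Lemma chebSS (R : nzRingType) m :
  cheb R m.+2 = 'X * cheb R m.+1 - cheb R m.
Proof. by []. Qed.

Lemma cheb_ind2 (P : nat -> Prop) : P 0%N -> P 1%N ->
  (forall m, P m -> P m.+1 -> P m.+2) -> forall m, P m.
Proof.
move=> P0 P1 PS m; suff: P m /\ P m.+1 by case.
by elim: m => [|m [Pm Pm1]]; split=> //; apply: PS.
Qed.

Lemma horner_cheb (F : fieldType) (m : nat) (x : F) : x != 0 ->
  (cheb F m).[x + x^-1] = tau m x.
Proof.
move=> x0; elim/cheb_ind2: m => [||m IH0 IH1].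
- by rewrite hornerC /tau expr0 invr1.
- by rewrite hornerX /tau expr1.
rewrite chebSS hornerD hornerN hornerM hornerX IH0 IH1 /tau !exprS.
by field; rewrite x0 expf_neq0.
Qed.

Definition dist (i l : nat) : nat := (i - l + (l - i))%N.

Lemma distC i l : dist i l = dist l i.
Proof. by rewrite /dist addnC. Qed.

Lemma mul_cheb (R : comNzRingType) (i l : nat) :
  cheb R i * cheb R l = cheb R (i + l) + cheb R (dist i l).
Proof.
wlog il : i l / (l <= i)%N => [wl|].
  case/orP: (leq_total l i) => [/wl //|/wl]; rewrite mulrC => ->.
  by rewrite addnC distC.
have -> : dist i l = (i - l)%N by rewrite /dist; lia.
elim/cheb_ind2: l il => [||l IH0 IH1] il.
- by rewrite addn0 subn0 [cheb R 0]/= polyC_natr; ring.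
- case: i il => // i _; rewrite addn1 subn1 chebSS /= mulrC; ring.
rewrite chebSS mulrBr mulrCA IH0 ?IH1; [|lia..].
have -> : (i + l.+2 = (i + l).+2)%N by lia.
have -> : (i - l = (i - l.+2).+2)%N by lia.
have -> : (i - l.+1 = (i - l.+2).+1)%N by lia.
rewrite !chebSS addnS; ring.
Qed.

Lemma size_lead_cheb (F : numFieldType) (m : nat) :
  size (cheb F m) = m.+1 /\ lead_coef (cheb F m) = if m == 0%N then 2 else 1.
Proof.
elim/cheb_ind2: m => [||m [s0 l0] [s1 l1]].
- by rewrite size_polyC lead_coefC pnatr_eq0.
- by rewrite size_polyX lead_coefX.
have cn0 : cheb F m.+1 != 0 by rewrite -size_poly_eq0 s1.
have sX : size ('X * cheb F m.+1) = m.+3 by rewrite mulrC size_mulX// s1.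
rewrite chebSS size_polyDl ?sX ?size_polyN ?s0// lead_coefDl ?sX ?size_polyN ?s0//.
by rewrite mulrC lead_coefMX l1.
Qed.

(** With [y = x + 1 / x], the derivative of [T_m] in [y] is [m (x ^ m - x ^ - m) / (x - 1 / x)].
    Multiplied by [(x - 1 / x) ^ 2 = y ^ 2 - 4], it becomes [m (T_(m+1) - T_(m-1))], which the
    recurrence brings to either form. Proving both together keeps the induction inside
    polynomials. *)
Lemma deriv_cheb (R : comNzRingType) (m : nat) :
  ('X^2 - 4) * (cheb R m)^`() = m%:R * (2 * cheb R m.+1 - 'X * cheb R m) /\
  ('X^2 - 4) * (cheb R m.+1)^`() =
    m.+1%:R * ('X * cheb R m.+1 - 2 * cheb R m).
Proof.
elim: m => [|m [A0 A1]].
  by rewrite /= derivC derivX; split; rewrite ?mulr0 ?mul0r ?mul1r ?mulr1//; ring.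
have E : (cheb R m.+2)^`() = cheb R m.+1 + 'X * (cheb R m.+1)^`() - (cheb R m)^`().
  by rewrite chebSS derivB derivM derivX mul1r.
split; first by rewrite A1 chebSS; ring.
rewrite E mulrBr mulrDr mulrCA A0 A1 chebSS -!natr1; ring.
Qed.

(** In the variable [x] the operator is [(x d/dx) ^ 2], with [x ^ m] and [x ^ - m] as
    eigenfunctions. In the induction, the recurrence leaves a term [2 (X ^ 2 - 4) T_(m+1)'], which
    [deriv_cheb] evaluates. *)
Lemma cheb_ode (R : comNzRingType) (m : nat) :
  ('X^2 - 4) * (cheb R m)^`()^`() + 'X * (cheb R m)^`() = (m ^ 2)%:R * cheb R m.
Proof.
elim/cheb_ind2: m => [||m IH0 IH1].
- by rewrite /= !derivC !mulr0 mul0r addr0.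
- by rewrite /= derivX derivC mulr0 mulr1 mul1r add0r.
have E : (cheb R m.+2)^`() = cheb R m.+1 + 'X * (cheb R m.+1)^`() - (cheb R m)^`().
  by rewrite chebSS derivB derivM derivX mul1r.
have E2 : (cheb R m.+2)^`()^`() = 2 * (cheb R m.+1)^`() +
    'X * (cheb R m.+1)^`()^`() - (cheb R m)^`()^`().
  rewrite E derivB derivD derivM derivX mul1r; ring.
have [_ A1] := deriv_cheb R m.
rewrite E2 E.
transitivity ('X * (('X^2 - 4) * (cheb R m.+1)^`()^`() + 'X * (cheb R m.+1)^`())
  - (('X^2 - 4) * (cheb R m)^`()^`() + 'X * (cheb R m)^`())
  + 2 * (('X^2 - 4) * (cheb R m.+1)^`()) + 'X * cheb R m.+1); first by ring.
rewrite IH0 IH1 A1 chebSS !natrX -!natr1; ring.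
Qed.

Local Arguments cheb : simpl never.

(** The factor 2 is the leading coefficient of [cheb F 0]; the other rows are monic. *)
Lemma det_tau (F : numFieldType) (k : nat) (x : 'I_k -> F) : (0 < k)%N ->
    (forall j, x j != 0) ->
  \det (\matrix_(i, j) tau i (x j)) =
  2 * \prod_(i < k) \prod_(j < k | (i < j)%N)
        ((x j + (x j)^-1) - (x i + (x i)^-1)).
Proof.
move=> k0 x0; transitivity (\det (\matrix_(i, j) (cheb F i).[x j + (x j)^-1])).
  by congr (\det _); apply/matrixP => i j; rewrite !mxE horner_cheb.
rewrite (@det_horner_lead _ _ (fun i : 'I_k => cheb F i)).
  congr (_ * _); case: k k0 {x x0} => // k _.
  rewrite big_ord_recl /= (size_lead_cheb F 0).2 big1 ?mulr1// => i _.
  by rewrite (size_lead_cheb F _).2.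
by move=> i; rewrite (size_lead_cheb F i).1.
Qed.

Lemma subr_addV (F : fieldType) (a b : F) : a != 0 -> b != 0 ->
  (b + b^-1) - (a + a^-1) = (b - a) * (1 - a^-1 * b^-1).
Proof. by move=> a0 b0; field; rewrite a0 b0. Qed.

Lemma prod_addV_neq0 (F : fieldType) (k : nat) (x : 'I_k -> F) :
    (forall j, x j != 0) ->
    (forall i j : 'I_k, (i < j)%N -> x i != x j /\ x i * x j != 1) ->
  \prod_(i < k) \prod_(j < k | (i < j)%N)
    ((x j + (x j)^-1) - (x i + (x i)^-1)) != 0.
Proof.
move=> x0 hx; apply/prodf_neq0 => i _; apply/prodf_neq0 => j ij.
have [h1 h2] := hx _ _ ij; rewrite subr_addV// mulf_neq0// subr_eq0 1?eq_sym//.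
by rewrite -invfM invr_eq1.
Qed.

End Chebyshev.

(** * Expansion of the Weyl denominator times a product of Chebyshev sums *)

Section Slater.

(** The coefficient of [T_m] in [T_i * \sum_l f l T_l], read off from [mul_cheb]. When [i] or [l] is
    0 the two indices agree and count twice, in accordance with [T_0 = 2]. *)
Definition ccoef (F : pzRingType) (N : nat) (f : nat -> F) (i m : nat) : F :=
  \sum_(l < N.+1) f l * ((m == i + l)%:R + (m == dist i l)%:R).

(** The coefficient of [prod_j T_(a_j) (y_j)] in [slater_expand]; it is antisymmetric in [a]. *)
Definition dcoef (F : comPzRingType) (N k : nat) (f : nat -> F)
    (a : {ffun 'I_k -> 'I_(N + k)}) : F :=
  \det (\matrix_(i < k, j < k) ccoef N f i (a j)).

Definition cheb_sum (F : comNzRingType) (N : nat) (f : nat -> F) : {poly F} :=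
  \sum_(l < N.+1) f l *: cheb F l.

Lemma sum_pick (V : nmodType) (n m : nat) (G : nat -> V) : (m < n)%N ->
  \sum_(i < n) G i *+ (i == m :> nat) = G m.
Proof.
move=> mn; rewrite (bigD1 (Ordinal mn))//= eqxx big1 ?addr0// => i.
by rewrite -val_eqE /= => /negPf ->.
Qed.

Lemma mul_cheb_sum (F : comNzRingType) (N k i : nat) (f : nat -> F) :
    (i < k)%N ->
  cheb_sum N f * cheb F i = \sum_(m < N + k) ccoef N f i m *: cheb F m.
Proof.
move=> ik; rewrite /cheb_sum mulr_suml.
under [RHS]eq_bigr => m _ do rewrite /ccoef scaler_suml.
rewrite exchange_big; apply: eq_bigr => l _ /=.
rewrite -scalerAl mulrC mul_cheb scalerDr.
under [RHS]eq_bigr => m _ do rewrite mulrDr scalerDl !mulr_natr -!scalerMnl.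
rewrite big_split /= !(@sum_pick _ _ _ (fun m => f l *: cheb F m))//.
  by have := ltn_ord l; rewrite /dist; lia.
by have := ltn_ord l; lia.
Qed.

Lemma horner_cheb_sum (F : fieldType) (N : nat) (f : nat -> F) (x : F) :
  x != 0 -> (cheb_sum N f).[x + x^-1] = \sum_(l < N.+1) f l * tau l x.
Proof.
move=> x0; rewrite horner_sum; apply: eq_bigr => l _.
by rewrite hornerZ horner_cheb.
Qed.

Lemma slater_expand (F : fieldType) (N k : nat) (f : nat -> F) (x : 'I_k -> F) :
    (forall j, x j != 0) ->
  (\prod_j (\sum_(l < N.+1) f l * tau l (x j))) *
    \det (\matrix_(i < k, j < k) tau i (x j)) =
  \sum_(a : {ffun 'I_k -> 'I_(N + k)})
    (\prod_j tau (a j) (x j)) * dcoef f a.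
Proof.
move=> x0; rewrite -det_scale_cols.
rewrite -(det_col_expand (fun (i : 'I_k) (m : 'I_(N + k)) => ccoef N f i m)
  (fun m j => tau m (x j))).
congr (\det _); apply/matrixP => i j; rewrite !mxE -horner_cheb_sum//.
rewrite -horner_cheb// -hornerM mulrC (@mul_cheb_sum _ _ k)// horner_sum.
by apply: eq_bigr => m _; rewrite hornerZ horner_cheb.
Qed.

Definition cheb_op (F : comNzRingType) (p : {poly F}) : {poly F} :=
  ('X^2 - 4) * p^`()^`() + 'X * p^`().

Lemma cheb_op_sum (F : comNzRingType) (n : nat) (c : 'I_n -> F)
    (p : 'I_n -> {poly F}) :
  cheb_op (\sum_i c i *: p i) = \sum_i c i *: cheb_op (p i).
Proof.
rewrite /cheb_op !raddf_sum /= !mulr_sumr -big_split; apply: eq_bigr => i _ /=.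
by rewrite !derivZ -!scalerAr scalerDr.
Qed.

Lemma cheb_opM (F : comNzRingType) (p : {poly F}) (i : nat) :
  cheb_op (p * cheb F i) = cheb_op p * cheb F i + (i ^ 2)%:R * p * cheb F i
    + 2 * ('X^2 - 4) * p^`() * (cheb F i)^`().
Proof.
rewrite -mulrA [(_ ^ 2)%:R * _]mulrCA -cheb_ode /cheb_op !(derivM, derivD); ring.
Qed.

(** Both sides are [sum_j L_j] applied to [det ((T_i phi) (y_j))]: on the left through the
    expansion, on the right through [cheb_opM] in each column. Its three terms give [L phi / phi],
    the sum of the [i ^ 2] by [sum_det_scale_col], and the cross terms by [det_set_col_deriv]. *)
Lemma slater_eigen (F : numFieldType) (N k : nat) (f : nat -> F)
    (x : 'I_k -> F) : (forall j, x j != 0) ->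
    injective (fun j => x j + (x j)^-1) ->
  let y j := x j + (x j)^-1 in
  let phi := cheb_sum N f in
    (forall j, phi.[y j] != 0) ->
  \sum_(a : {ffun 'I_k -> 'I_(N + k)})
    (\sum_j (a j) ^ 2)%:R * (\prod_j tau (a j) (x j) * dcoef f a) =
  (\prod_j phi.[y j]) * \det (\matrix_(i < k, j < k) tau i (x j)) *
  (\sum_j (cheb_op phi).[y j] / phi.[y j] + (\sum_(i < k) i ^ 2)%:R
   + 2 * \sum_j \sum_(i | i != j)
       (y j ^+ 2 - 4) * (phi^`().[y j] / phi.[y j]) / (y j - y i)).
Proof.
move=> x0 yI y phi phi0; pose V := \matrix_(i < k, j < k) (cheb F i).[y j].
have -> : \matrix_(i < k, j < k) tau i (x j) = V.
  by apply/matrixP => i j; rewrite !mxE horner_cheb.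
pose Mx := \matrix_(i < k, j < k) (phi.[y j] * (cheb F i).[y j]).
have phiE (i : 'I_k) : phi * cheb F i = \sum_(m < N + k) ccoef N f i m *: cheb F m.
  exact: mul_cheb_sum.
transitivity (\sum_j \det (set_col Mx j (fun i => (cheb_op (phi * cheb F i)).[y j]))).
  under eq_bigr => a _ do rewrite natr_sum mulr_suml.
  rewrite exchange_big; apply: eq_bigr => j _ /=.
  (* The eigenvalue [m ^ 2] enters in column [j] only, so that [det_col_expand] still applies. *)
  pose w (m : 'I_(N + k)) (j' : 'I_k) :=
    (if j' == j then (m ^ 2)%:R else 1) * tau m (x j').
  transitivity (\sum_(a : {ffun 'I_k -> 'I_(N + k)})
      (\prod_j' w (a j') j') * dcoef f a).
    apply: eq_bigr => a _; rewrite mulrA; congr (_ * _).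
    rewrite (bigD1 j)//= [RHS](bigD1 j)//= /w eqxx -mulrA; congr (_ * (_ * _)).
    by apply: eq_bigr => j' /negPf ->; rewrite mul1r.
  rewrite -(det_col_expand (fun (i : 'I_k) (m : 'I_(N + k)) => ccoef N f i m) w).
  congr (\det _); apply/matrixP => i j'.
  rewrite !mxE /w phiE; case: eqP => [->|_].
    rewrite cheb_op_sum horner_sum; apply: eq_bigr => m _.
    rewrite hornerZ /cheb_op cheb_ode hornerM horner_cheb//.
    by rewrite -polyC_natr hornerC.
  rewrite -hornerM phiE horner_sum; apply: eq_bigr => m _.
  by rewrite mul1r hornerZ horner_cheb.
have colE j : \det (set_col Mx j (fun i => (cheb_op (phi * cheb F i)).[y j])) =
  (\prod_j phi.[y j]) * ((cheb_op phi).[y j] / phi.[y j] * \det V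
    + \det (set_col V j (fun i => (i ^ 2)%:R * V i j))
    + 2 * (y j ^+ 2 - 4) * (phi^`().[y j] / phi.[y j])
        * \det (set_col V j (fun i => (cheb F i)^`().[y j]))).
  have VE : \det V = \det (set_col V j (fun i => V i j)).
    by congr (\det _); apply/matrixP => a b; rewrite !mxE; case: eqP => // ->.
  have -> : set_col Mx j (fun i => (cheb_op (phi * cheb F i)).[y j]) =
     \matrix_(i, j') (set_col V j (fun i => (cheb_op (phi * cheb F i)).[y j]
        / phi.[y j]) i j' * phi.[y j']).
    apply/matrixP => a b; rewrite !mxE; case: eqP => [->|_].
      by rewrite divfK.
    by rewrite mulrC.
  rewrite det_scale_cols VE !det_set_col; congr (_ * _).
  rewrite !mulr_sumr -!big_split; apply: eq_bigr => i _ /=.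
  rewrite cheb_opM !(hornerD, hornerM, hornerN, hornerX) !mxE -!polyC_natr !hornerC.
  by field; exact: phi0.
have sV i : (size (cheb F (i : 'I_k)) <= k)%N by rewrite (size_lead_cheb F i).1.
rewrite (eq_bigr _ (fun j _ => colE j)).
under eq_bigr => j _ do rewrite (det_set_col_deriv j (p := fun i : 'I_k => cheb F i) sV yI).
rewrite -mulr_sumr -[RHS]mulrA; congr (_ * _).
rewrite !big_split /= sum_det_scale_col -mulr_suml !mulrDr.
rewrite mulrC; congr (_ + _ + _); first by rewrite natr_sum mulrC.
rewrite !mulr_sumr; apply: eq_bigr => j _.
rewrite mulrCA; congr (_ * _); rewrite -mulrA -mulrA; congr (_ * _).
by rewrite mulrA !mulr_sumr.
Qed.

End Slater.

(** * The top exponents and their coefficients *)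

Section TopCoefficient.

(** The set [A] of values is compared with [T = {N, ..., N + k - 1}], of the same size. Trading the
    elements of [A] below [N] for the missing ones of [T] strictly raises the sum of squares, so
    equality forces [A] inside [T]. *)
Lemma sum_sqr_top (N k : nat) (a : 'I_k -> 'I_(N + k)) : injective a ->
    (\sum_j (a j) ^ 2 = \sum_(i < k) (N + i) ^ 2)%N ->
  forall j, (N <= a j)%N.
Proof.
move=> aI sa j.
pose A := [set a j | j in 'I_k]; pose T := [set rshift N i | i in 'I_k].
have TE : T = [set m : 'I_(N + k) | (N <= m)%N].
  apply/setP => m; rewrite inE; apply/imsetP/idP => [[i _ ->]|Nm].
    by rewrite /= leq_addr.
  have mk : (m - N < k)%N by have := ltn_ord m; lia.
  by exists (Ordinal mk) => //; apply: val_inj => /=; rewrite subnKC.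
have cA : #|A| = k by rewrite card_imset// card_ord.
have cT : #|T| = k by rewrite card_imset ?card_ord//; exact: rshift_inj.
have sA : (\sum_(m in A) m ^ 2 = \sum_j (a j) ^ 2)%N.
  by rewrite big_imset//= => ? ? _ _; exact: aI.
have sT : (\sum_(m in T) m ^ 2 = \sum_(i < k) (N + i) ^ 2)%N.
  by rewrite big_imset//= => ? ? _ _; exact: rshift_inj.
have cD : #|A :\: T| = #|T :\: A|.
  by apply: (@addnI #|A :&: T|); rewrite cardsID finset.setIC cardsID cA cT.
(* The summand [#|A :\: T|] records strictness: one unit for each element below [N]. *)
have le1 : (\sum_(m in A :\: T) m ^ 2 + #|A :\: T| <= #|A :\: T| * N ^ 2)%N.
  rewrite -sum_nat_const -sum1_card -big_split; apply: leq_sum => m.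
  by rewrite inE TE inE -ltnNge => /andP[mN _]; rewrite /= addn1 ltn_exp2r.
have le2 : (#|T :\: A| * N ^ 2 <= \sum_(m in T :\: A) m ^ 2)%N.
  rewrite -sum_nat_const; apply: leq_sum => m.
  by rewrite inE TE inE => /andP[_ mN]; rewrite leq_exp2r.
have := sa; rewrite -sA -sT (big_setID T) [RHS](big_setID A) /= (finset.setIC T A) => /addnI e.
rewrite -cD in le2; have := leq_trans le1 le2.
rewrite e -[leqRHS]addn0 leq_add2l leqn0.
rewrite cards_eq0 finset.setD_eq0 TE => /fintype.subsetP/(_ (a j)); rewrite inE; apply.
exact: imset_f.
Qed.

(** The sign of the rearrangement if [a] permutes [N, ..., N + k - 1], and 0 otherwise; as a
    determinant it fits [det_col_expand]. *)
Definition top_det (F : comPzRingType) (N k : nat) (a : {ffun 'I_k -> 'I_(N + k)}) : F :=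
  \det (\matrix_(i < k, j < k) (a j == (N + i)%N :> nat)%:R).

Lemma det_eq_cols (F : comPzRingType) (k : nat) (M : 'M[F]_k) (j0 j1 : 'I_k) :
  j0 != j1 -> (forall i, M i j0 = M i j1) -> \det M = 0.
Proof.
move=> j01 e; rewrite -det_tr; apply: (determinant_alternate j01) => i.
by rewrite !mxE.
Qed.

Lemma top_det_eq0 (F : comNzRingType) (N k : nat) (a : {ffun 'I_k -> 'I_(N + k)}) :
    (\sum_j (a j) ^ 2 <> \sum_(i < k) (N + i) ^ 2)%N ->
  top_det F a = 0.
Proof.
move=> sa; have [aI|/injectivePn[j0 [j1 j01 e]]] := boolP (injectiveb a); last first.
  by apply: (det_eq_cols j01) => i; rewrite !mxE e.
have [h|] := boolP [forall j, (N <= a j)%N]; last first.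
  rewrite negb_forall => /existsP[j]; rewrite -ltnNge => aN.
  rewrite /top_det (expand_det_col _ j) big1// => i _; rewrite mxE.
  by case: eqP => [e|_]; [lia|rewrite mul0r].
have lt j : (a j - N < k)%N by have := ltn_ord (a j); have := forallP h j; lia.
pose s j := Ordinal (lt j).
have sI : injective s.
  move=> i j /(congr1 val) /= e; apply: (injectiveP _ aI); apply: val_inj.
  by have := forallP h j; have := forallP h i; move: e => /=; lia.
case: sa; rewrite [RHS](reindex s) /=; last exact/onW_bij/injF_bij.
by apply: eq_bigr => j _; rewrite /= subnKC//; exact: (forallP h).
Qed.

(** For injective [a] all [a j] are at least [N], and the matrix factors through the triangular [L].
    The diagonal of [L] involves only [f N = 1], with a 2 in row 0, where [i + N] and [dist i N]
    coincide; the other values of [f] thus drop out. *)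
Lemma dcoef_top (F : comNzRingType) (N k : nat) (f : nat -> F)
    (a : {ffun 'I_k -> 'I_(N + k)}) : (0 < N)%N -> (0 < k)%N -> f N = 1 ->
    (\sum_j (a j) ^ 2 = \sum_(i < k) (N + i) ^ 2)%N ->
  dcoef f a = 2 * top_det F a.
Proof.
move=> N0 k0 fN sa.
have [aI|/injectivePn[j0 [j1 j01 e]]] := boolP (injectiveb a); last first.
  rewrite /dcoef /top_det !(det_eq_cols j01) ?mulr0// => i; by rewrite !mxE e.
have aN := sum_sqr_top (injectiveP _ aI) sa.
pose L := \matrix_(i < k, i' < k) ccoef N f i (N + i').
have -> : dcoef f a = \det (L *m \matrix_(i < k, j < k) (a j == (N + i)%N :> nat)%:R).
  congr (\det _); apply/matrixP => i j; rewrite !mxE.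
  have lt : (a j - N < k)%N by have := ltn_ord (a j); have := aN j; lia.
  rewrite (bigD1 (Ordinal lt))//= big1 ?addr0 => [|i' /eqP ii].
    by rewrite !mxE /= subnKC// eqxx mulr1.
  rewrite !mxE; case: eqP => [e|_]; last by rewrite mulr0.
  by case: ii; apply: val_inj => /=; rewrite e addKn.
rewrite det_mulmx; congr (_ * _); rewrite det_trig; last first.
  apply/is_trig_mxP => i i' ii'; rewrite mxE /ccoef big1// => l _.
  have := ltn_ord l; rewrite /dist => ll.
  by case: eqP => [?|_]; [lia|]; case: eqP => [?|_]; [lia|]; rewrite addr0 mulr0.
have LE (i : 'I_k) : L i i = if i == 0%N :> nat then 2 else 1.
  rewrite mxE /ccoef big_ord_recr big1 /=.
    rewrite fN add0r mul1r (addnC N) eqxx.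
    have -> : ((i + N)%N == dist i N) = (i == 0%N :> nat).
      by rewrite /dist; apply/eqP/eqP; lia.
    by case: eqP => _; [rewrite -natrD|rewrite addr0].
  move=> l _; have := ltn_ord l; rewrite /dist => ll.
  by case: eqP => [?|_]; [lia|]; case: eqP => [?|_]; [lia|]; rewrite addr0 mulr0.
case: k k0 {a sa aI aN} L LE => // k _ L LE.
rewrite big_ord_recl LE eqxx big1 ?mulr1// => i _; by rewrite LE.
Qed.

Lemma sum_top_det (F : fieldType) (N k : nat) (x : 'I_k -> F) :
  \sum_(a : {ffun 'I_k -> 'I_(N + k)}) (\prod_j tau (a j) (x j)) * top_det F a =
  \det (\matrix_(i < k, j < k) tau (N + i) (x j)).
Proof.
rewrite -(det_col_expand (fun (i : 'I_k) (m : 'I_(N + k)) => (m == (N + i)%N :> nat)%:R)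
  (fun m j => tau m (x j))).
congr (\det _); apply/matrixP => i j; rewrite !mxE.
under eq_bigr => m _ do rewrite mulr_natl.
by rewrite (sum_pick (fun m => tau m (x j)))// ltn_add2l.
Qed.

(** On a grid with [M] sample points per coordinate, the system is the tensor product of the
    matrices [Q j], invertible by [det_tau]. Applying the inverses coordinate by coordinate isolates
    [b a0]. *)
Lemma tau_prod_free (F : numFieldType) (M k : nat) (b : {ffun 'I_k -> 'I_M} -> F) :
    (0 < M)%N ->
    (forall x : 'I_k -> F, (forall j, 0 < x j < 1) -> injective x ->
      \sum_(a : {ffun 'I_k -> 'I_M}) (\prod_j tau (a j) (x j)) * b a = 0) ->
  forall a, b a = 0.
Proof.
move=> M0 hb a0.
(* Distinct coordinates get disjoint sets of sample points, since [hb] only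
   covers injective [x]. *)
pose t (j : 'I_k) (s : 'I_M) : F := (j * M + s + 2)%:R^-1.
have t01 j s : 0 < t j s < 1.
  have h : 1 < (j * M + s + 2)%:R :> F by rewrite ltr1n addn2.
  by rewrite /t invr_gt0 invf_lt1 ?h ?(lt_trans ltr01 h).
have tI j j' s s' : t j s = t j' s' -> j = j' /\ s = s'.
  move=> /invr_inj/eqP; rewrite eqr_nat !addn2 !eqSS => /eqP e.
  have es : s = s' :> nat.
    by have := congr1 (modn^~ M) e; rewrite !modnMDl !modn_small.
  split; last exact: val_inj.
  apply: val_inj; move: e; rewrite es => /addIn/eqP; rewrite eqn_pmul2r//.
  by move/eqP.
pose Q j := \matrix_(m < M, s < M) tau m (t j s).
have Qu j : Q j \in unitmx.
  rewrite unitmxE unitfE det_tau// => [|s]; last by case/andP: (t01 j s) => /gt_eqF ->.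
  rewrite mulf_neq0 ?pnatr_eq0//; apply: prod_addV_neq0 => s.
    by case/andP: (t01 j s) => /gt_eqF ->.
  move=> s' ss'; split; first by apply/eqP => /tI[_ e]; rewrite e ltnn in ss'.
  have /andP[p1 p2] := t01 j s; have /andP[p3 p4] := t01 j s'.
  by rewrite lt_eqF// mulr_ilt1// ltW.
have : \sum_(s : {ffun 'I_k -> 'I_M}) (\prod_j invmx (Q j) (s j) (a0 j)) *
    (\sum_(a : {ffun 'I_k -> 'I_M}) (\prod_j tau (a j) (t j (s j))) * b a) = 0.
  rewrite big1// => s _; rewrite (hb (fun j => t j (s j))) ?mulr0//.
  by move=> j j' /tI[].
under eq_bigr => s _ do rewrite mulr_sumr.
rewrite exchange_big /= => <-.
have E (a : {ffun 'I_k -> 'I_M}) : \sum_(s : {ffun 'I_k -> 'I_M})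
    (\prod_j invmx (Q j) (s j) (a0 j)) * ((\prod_j tau (a j) (t j (s j))) * b a)
    = (a == a0)%:R * b a.
  under eq_bigr => s _ do rewrite mulrA -big_split.
  rewrite -mulr_suml /=; congr (_ * _).
  rewrite -(bigA_distr_bigA (fun j s => invmx (Q j) s (a0 j) * tau (a j) (t j s))).
  transitivity (\prod_j ((a j == a0 j)%:R : F)).
    apply: eq_bigr => j _; have := congr1 (fun X : 'M[F]_M => X (a j) (a0 j)) (mulmxV (Qu j)).
    by rewrite !mxE => <-; apply: eq_bigr => s _; rewrite !mxE mulrC.
  rewrite -natr_prod; case: (eqVneq a a0) => [->|ne].
    by rewrite big1// => j _; rewrite eqxx.
  have /existsP[j nj] : [exists j, a j != a0 j].
    rewrite -negb_forall; apply: contra ne => /forallP h.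
    by apply/eqP/ffunP => j; apply/eqP.
  by rewrite (bigD1 j)//= (negPf nj) mul0n.
rewrite (eq_bigr _ (fun a _ => E a)) (bigD1 a0)//= eqxx mul1r big1 ?addr0// => a.
by move/negPf ->; rewrite mul0r.
Qed.

End TopCoefficient.

(** * The sum over sign vectors *)

Section SignSum.

Lemma sign_sum (F : numFieldType) (N k : nat) (x : 'I_k -> F) : (0 < k)%N ->
    (forall j, x j != 0) ->
    (forall i j : 'I_k, (i < j)%N -> x i != x j /\ x i * x j != 1) ->
  \sum_(e : {ffun 'I_k -> bool})
     (\prod_(j < k) x j ^ (N%:Z * (1 - (-1) ^+ e j)))
     * \prod_(i < k) \prod_(j < k | (i < j)%N)
         (1 - x i ^ ((-1) ^+ e i) * x j ^ ((-1) ^+ e j))^-1 =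
  (\prod_(j < k) x j) ^+ N *
    (2 * \det (\matrix_(i < k, j < k) tau (N + i) (x j))
       / \det (\matrix_(i < k, j < k) tau i (x j))).
Proof.
move=> k0 x0 hx; rewrite det_tau//; have := prod_addV_neq0 x0 hx; set D := \prod_(i < k) _ => D0.
(* [z (e j) j] is [x_j] to the power minus the sign encoded by [e j]. *)
pose z (b : bool) (j : 'I_k) := if b then x j else (x j)^-1.
have z0 b j : z b j != 0 by case: b; rewrite /= ?invr_eq0.
have zV (b : bool) j : x j ^ ((-1) ^+ b) = (z b j)^-1.
  by case: b; rewrite ?expr1 ?expr0 /z ?invrK.
have zN (b : bool) j : x j ^ (N%:Z * (1 - (-1) ^+ b)) = x j ^+ N * z b j ^+ N.
  case: b; rewrite ?expr1 ?expr0 /z.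
    by rewrite opprK mulrDr mulr1 exprzDr ?unitfE.
  by rewrite subrr mulr0 expr0z exprVn divff// expf_neq0.
have -> : \matrix_(i < k, j < k) tau (N + i) (x j) =
    \matrix_(i < k, j < k) \sum_(b : bool) z b j ^+ (N + i).
  by apply/matrixP => i j; rewrite !mxE /tau big_bool /= exprVn.
rewrite (det_col_sum (fun i j b => z b j ^+ (N + i))).
rewrite -mulf_div divff ?pnatr_eq0// mul1r mulr_suml mulr_sumr.
apply: eq_bigr => e _; rewrite (eq_bigr _ (fun j _ => zN (e j) j)); pose a := \row_j z (e j) j : 'rV[F]_k.
have -> : \matrix_(i < k, j < k) z (e j) j ^+ (N + i) =
    \matrix_(i, j) (Vandermonde k a i j * z (e j) j ^+ N).
  by apply/matrixP => i j; rewrite !mxE exprD mulrC.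
rewrite big_split /= det_scale_cols det_Vandermonde -prodrXl -!mulrA.
congr (_ * (_ * _)).
(* Inverting some of the [x_j] leaves every [x_j + 1 / x_j] unchanged, so the same [D] factors for
   each [e], into the Vandermonde product of the [z (e j) j] and the denominator of the term of
   [e]. *)
have DE : D = (\prod_(i < k) \prod_(j < k | (i < j)%N) (a 0 j - a 0 i)) *
    \prod_(i < k) \prod_(j < k | (i < j)%N) (1 - (a 0 i)^-1 * (a 0 j)^-1).
  rewrite -big_split; apply: eq_bigr => i _; rewrite -big_split /=.
  apply: eq_bigr => j _; rewrite !mxE -subr_addV//.
  by congr (_ - _); rewrite /z; case: (e _); rewrite // invrK addrC.
rewrite DE invfM mulVKf; last by apply: contraNneq D0 => h; rewrite DE h mul0r.
rewrite -prodfV; apply: eq_bigr => i _; rewrite -prodfV; apply: eq_bigr => j _.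
by rewrite !mxE !zV.
Qed.

End SignSum.
(** * Resolvents and plane rotations *)

Section Resolvent.

Lemma map_char_poly_mxN (R : comNzRingType) (n : nat) (g : 'M[R]_n) (x : R) :
  map_mx (horner_eval x) (char_poly_mx (- g)) = x%:M + g.
Proof.
apply/matrixP => i j; rewrite !mxE /horner_eval /= hornerD hornerN hornerMn.
by rewrite hornerX hornerC opprK.
Qed.

Lemma horner_char_polyN (R : comNzRingType) (n : nat) (g : 'M[R]_n) (x : R) :
  (char_poly (- g)).[x] = \det (x%:M + g).
Proof.
rewrite /char_poly -[LHS]/(horner_eval x _) -det_map_mx.
by rewrite map_char_poly_mxN.
Qed.

Lemma deriv_char_poly_mx (R : comNzRingType) (n : nat) (g : 'M[R]_n) i j :
  (char_poly_mx g i j)^`() = (i == j)%:R.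
Proof. by rewrite !mxE derivB derivMn derivX derivC subr0. Qed.

(** The entrywise derivative of the characteristic matrix is the identity, so Jacobi's formula
    collapses to a trace. *)
Lemma deriv_char_poly (R : comNzRingType) (n : nat) (g : 'M[R]_n) :
  (char_poly g)^`() = \tr (\adj (char_poly_mx g)).
Proof.
rewrite /char_poly deriv_det; apply: eq_bigr => a _; rewrite mxE.
rewrite (bigD1 a)//= big1 => [|b ba]; rewrite deriv_char_poly_mx.
  by rewrite eqxx mul1r addr0.
by rewrite eq_sym (negPf ba) mul0r.
Qed.

(** The factor [x] makes its trace equal to [x d/dx log det (x + g)]. *)
Definition resolvent (F : fieldType) (n : nat) (g : 'M[F]_n) (x : F) : 'M[F]_n :=
  x *: invmx (x%:M + g).

Lemma deriv1_char_polyN (F : fieldType) (n : nat) (g : 'M[F]_n) (x : F) :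
    x%:M + g \in unitmx ->
  x * (char_poly (- g))^`().[x] =
  (char_poly (- g)).[x] * \tr (resolvent g x).
Proof.
move=> ug; rewrite deriv_char_poly -[_.[x]]/(horner_eval x _) -trace_map_mx.
rewrite map_mx_adj horner_char_polyN /resolvent mxtraceZ /invmx ug mxtraceZ.
by rewrite map_char_poly_mxN mulrCA mulVKf// -unitfE -unitmxE.
Qed.

(** Differentiating [\adj M *m M = p] expresses the derivative [A1] of the adjugate at [x] through
    [C] and [C ^ 2]; its trace is the second derivative of [p]. *)
Lemma deriv2_char_polyN (F : fieldType) (n : nat) (g : 'M[F]_n) (x : F) :
    x%:M + g \in unitmx ->
  x ^+ 2 * (char_poly (- g))^`()^`().[x] = (char_poly (- g)).[x] *
   (\tr (resolvent g x) ^+ 2 - \tr (resolvent g x *m resolvent g x)).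
Proof.
move=> ug; set p := char_poly (- g); set M := char_poly_mx (- g).
set C := invmx (x%:M + g).
have Mx : map_mx (horner_eval x) M = x%:M + g by exact: map_char_poly_mxN.
pose A1 := map_mx (horner_eval x \o @deriv F) (\adj M).
have adjx : map_mx (horner_eval x) (\adj M) = p.[x] *: C.
  rewrite map_mx_adj Mx /C /invmx ug /p horner_char_polyN scalerA divff ?scale1r//.
  by rewrite -unitfE -unitmxE.
have E : A1 *m (x%:M + g) + p.[x] *: C = (p^`().[x])%:M.
  rewrite -adjx -Mx; apply/matrixP => i j.
  have := congr1 (fun X : 'M[{poly F}]_n => (X i j)^`().[x]) (mul_adj_mx M).
  rewrite !mxE derivMn hornerMn => <-.
  rewrite raddf_sum horner_sum /=.
  under [RHS]eq_bigr => l _ do rewrite derivM hornerD !hornerM.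
  rewrite big_split /=; congr (_ + _).
    by apply: eq_bigr => l _; rewrite !mxE.
  rewrite (bigD1 j)//= big1 ?addr0 => [|l lj]; rewrite deriv_char_poly_mx.
    by rewrite eqxx hornerC mulr1 mxE.
  by rewrite (negPf lj) horner0 mulr0.
have A1E : A1 = p^`().[x] *: C - p.[x] *: (C *m C).
  have := congr1 (mulmx^~ C) E; rewrite mulmxDl -mulmxA mulmxV// mulmx1.
  by rewrite -scalemxAl mul_scalar_mx => <-; rewrite addrK.
have -> : p^`()^`().[x] = \tr A1.
  rewrite deriv_char_poly raddf_sum horner_sum; apply: eq_bigr => i _.
  by rewrite !mxE.
rewrite A1E raddfB /= !mxtraceZ /resolvent -/C -scalemxAl -scalemxAr !mxtraceZ.
have := deriv1_char_polyN ug; rewrite -/p /resolvent -/C mxtraceZ => e.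
transitivity ((x * p^`().[x]) * (x * \tr C) - x ^+ 2 * p.[x] * \tr (C *m C)).
  ring.
rewrite e; ring.
Qed.

(** The resolvent identity, which reduces traces of products to traces of single resolvents. *)
Lemma resolvent_mul (F : fieldType) (n : nat) (g : 'M[F]_n) (x y : F) :
    x%:M + g \in unitmx -> y%:M + g \in unitmx ->
  (x - y) *: (resolvent g x *m resolvent g y) =
  x *: resolvent g y - y *: resolvent g x.
Proof.
move=> ux uy; rewrite /resolvent; set A := x%:M + g; set B := y%:M + g.
have AB : A - B = (x - y)%:M by rewrite /A /B opprD addrACA subrr addr0 raddfB.
have : invmx A *m (A - B) *m invmx B = invmx B - invmx A.
  by rewrite mulmxBr mulmxBl mulVmx// mul1mx -mulmxA mulmxV// mulmx1.
rewrite AB mul_mx_scalar -scalemxAl => e.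
rewrite -scalemxAl -scalemxAr !scalerA.
have -> : (x - y) * x * y = x * y * (x - y) by ring.
by rewrite -scalerA e scalerBr (mulrC y x).
Qed.

(** The analogue for [g^T], the inverse of [g]: with [A = x + g] and [B = y + g^T], one has
    [A B - x B - y A = 1 - x y]. *)
Lemma resolvent_mul_tr (F : fieldType) (n : nat) (g : 'M[F]_n) (x y : F) :
    g *m g^T = 1%:M -> x%:M + g \in unitmx -> y%:M + g \in unitmx ->
  (1 - x * y) *: (resolvent g x *m (resolvent g y)^T) =
  (x * y) *: (1%:M - resolvent g x - (resolvent g y)^T).
Proof.
move=> gg ux uy; rewrite /resolvent linearZ /= trmx_inv linearD /= tr_scalar_mx.
have uyt : y%:M + g^T \in unitmx.
  by rewrite -(tr_scalar_mx _ y) -linearD unitmx_tr.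
set A := x%:M + g; set B := y%:M + g^T.
have E : A *m B - x *: B - y *: A = (1 - x * y)%:M.
  rewrite /A /B mulmxDl !mulmxDr gg mul_scalar_mx mul_mx_scalar.
  rewrite !scalerDr mul_scalar_mx !scale_scalar_mx raddfB /= (mulrC y x).
  by apply/matrixP => i j; rewrite !mxE; case: eqP => _; rewrite ?mulr1n ?mulr0n; ring.
have e : 1%:M - x *: invmx A - y *: invmx B =
    (1 - x * y) *: (invmx A *m invmx B).
  have := congr1 (fun X => invmx A *m X *m invmx B) E.
  rewrite mul_mx_scalar -scalemxAl !mulmxBr !mulmxBl => <-.
  rewrite -!scalemxAr -!scalemxAl !mulmxA mulVmx// mul1mx mulmxV// mul1mx.
  by rewrite -[invmx A *m B *m _]mulmxA mulmxV// mulmx1.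
rewrite -scalemxAl -scalemxAr e !scalerA; congr (_ *: _); ring.
Qed.

End Resolvent.
Section Rotation.

Definition plane_emb (R : pzRingType) (n : nat) (a b : 'I_n) : 'M[R]_(n, 2) :=
  \matrix_(i, l) (i == if l == 0 then a else b)%:R.

(** The 2 x 2 rotation minus the identity. *)
Definition plane_gen (R : pzRingType) (s u : R) : 'M[R]_2 :=
  \matrix_(l, m) if l == m then - u else if l == 0 then s else - s.

(* Rotation by t in the plane of the axes a and b, with s = sin t, u = 1 - cos t. *)
Definition rotation (R : pzRingType) (n : nat) (s u : R) (a b : 'I_n) : 'M[R]_n :=
  1%:M + plane_emb R a b *m plane_gen s u *m (plane_emb R a b)^T.

Lemma plane_emb_mul (R : pzRingType) (n : nat) (a b : 'I_n) (Z : 'M[R]_n) l m :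
  ((plane_emb R a b)^T *m Z *m plane_emb R a b) l m =
  Z (if l == 0 then a else b) (if m == 0 then a else b).
Proof.
rewrite mxE (bigD1 (if m == 0 then a else b))//= big1 ?addr0 => [|i ib].
  rewrite [plane_emb _ _ _ _ _]mxE eqxx mulr1 mxE.
  rewrite (bigD1 (if l == 0 then a else b))//= big1 ?addr0 => [|i ib].
    by rewrite !mxE eqxx mul1r.
  by rewrite !mxE (negPf ib) mul0r.
by rewrite [plane_emb _ _ _ _ _]mxE (negPf ib) mulr0.
Qed.

Lemma ord2P (l : 'I_2) : l = 0 \/ l = 1.
Proof. by case: l => [[|[|//]] ?]; [left|right]; apply: val_inj. Qed.

Lemma plane_emb_orth (R : pzRingType) (n : nat) (a b : 'I_n) : a != b ->
  (plane_emb R a b)^T *m plane_emb R a b = 1%:M.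
Proof.
move=> ab; rewrite -[_^T]mulmx1; apply/matrixP => l m; rewrite plane_emb_mul !mxE.
by case: (ord2P l) => ->; case: (ord2P m) => ->;
  rewrite /= ?eqxx ?(negPf ab) ?[b == a]eq_sym ?(negPf ab).
Qed.

(** [det_addmulC] leaves a 2 x 2 determinant in which the squares of [s] and [u] occur only as
    [s ^ 2 + u ^ 2]; the relation makes it affine in [s] and [u]. *)
Lemma det_rotation_pert (R : comPzRingType) (n : nat) (s u : R) (a b : 'I_n)
    (Z : 'M[R]_n) : s ^+ 2 + u ^+ 2 = 2 * u ->
  \det (1%:M + (rotation s u a b - 1%:M) *m Z) =
  1 + s * (Z b a - Z a b)
    + u * (2 * (Z a a * Z b b - Z a b * Z b a) - Z a a - Z b b).
Proof.
move=> su; rewrite /rotation addrAC subrr add0r -!mulmxA det_addmulC -mulmxA.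
set W := _ *m plane_emb R a b.
have WE l m : W l m = Z (if l == 0 then a else b) (if m == 0 then a else b).
  by rewrite -plane_emb_mul.
rewrite det_mx2 !mxE !big_ord_recl !big_ord0 !WE !mxE /=.
transitivity (1 + s * (Z b a - Z a b) - u * (Z a a + Z b b)
  + (s ^+ 2 + u ^+ 2) * (Z a a * Z b b - Z a b * Z b a)); last by rewrite su; ring.
ring.
Qed.

Lemma det_rotation (R : comPzRingType) (n : nat) (s u : R) (a b : 'I_n) :
  s ^+ 2 + u ^+ 2 = 2 * u -> a != b -> \det (rotation s u a b) = 1.
Proof.
move=> su ab; have := det_rotation_pert a b 1%:M su.
rewrite mulmx1 addrC subrK => ->; rewrite !mxE !eqxx (negPf ab) eq_sym (negPf ab).
rewrite /= !mulr0n mulr1n; ring.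
Qed.

Lemma rotation_orth (R : comPzRingType) (n : nat) (s u : R) (a b : 'I_n) :
    s ^+ 2 + u ^+ 2 = 2 * u -> a != b ->
  (rotation s u a b)^T *m rotation s u a b = 1%:M.
Proof.
move=> su ab; rewrite /rotation; set U := plane_emb R a b; set K := plane_gen s u.
(* This is the orthogonality of the 2 x 2 matrix [1 + K]. *)
have KE : K^T + K + K^T *m K = 0.
  apply/matrixP => l m; rewrite !mxE !big_ord_recl big_ord0 !mxE /=.
  have e : s * s = 2 * u - u * u by rewrite -su; ring.
  by case: (ord2P l) => ->; case: (ord2P m) => ->; rewrite /= ?mulrNN ?e; ring.
rewrite [(_ + _)^T]linearD /= trmx1 !trmx_mul trmxK mulmxDl !mulmxDr !mul1mx mulmx1.
have -> : U *m (K^T *m U^T) *m (U *m K *m U^T) = U *m (K^T *m K) *m U^T.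
  by rewrite !mulmxA -(mulmxA _ U^T U) plane_emb_orth// mulmx1.
rewrite -addrA mulmxA -mulmxDl -mulmxDr -mulmxDl -mulmxDr.
by rewrite addrA [K + _]addrC KE mulmx0 mul0mx addr0.
Qed.

(** With [r] the rotation, [x r + g = (1 + (r - 1) Z) (x + g)]. *)
Lemma det_rotation_add (F : fieldType) (n : nat) (g : 'M[F]_n) (x s u : F)
    (a b : 'I_n) : x%:M + g \in unitmx -> s ^+ 2 + u ^+ 2 = 2 * u ->
  let Z := resolvent g x in
  \det (x *: rotation s u a b + g) = \det (x%:M + g) *
  (1 + s * (Z b a - Z a b)
     + u * (2 * (Z a a * Z b b - Z a b * Z b a) - Z a a - Z b b)).
Proof.
move=> ug su Z; rewrite -(det_rotation_pert a b Z su) mulrC -det_mulmx mulmxDl mul1mx.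
congr (\det _); rewrite -mulmxA /Z /resolvent -scalemxAl mulVmx// -scalemxAr mulmx1.
by rewrite scalerBr scalemx1 [RHS]addrC addrA subrK.
Qed.

Lemma sum_plane_minors (F : comPzRingType) (n : nat) (Z : 'M[F]_n) :
  \sum_a \sum_(b | b != a)
     (2 * (Z a a * Z b b - Z a b * Z b a) - Z a a - Z b b) =
  2 * (\tr Z ^+ 2 - \tr (Z *m Z) - (n%:R - 1) * \tr Z).
Proof.
(* The term [b = a] of the full sum is [- 2 * Z a a], since its minor vanishes. *)
transitivity (\sum_a ((\sum_b (2 * (Z a a * Z b b - Z a b * Z b a) - Z a a - Z b b))
   + 2 * Z a a)).
  apply: eq_bigr => a _; rewrite [in RHS](bigD1 a)//=; ring.
have E1 : \sum_a \sum_b Z a a * Z b b = \tr Z ^+ 2.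
  by rewrite expr2 mulr_suml; apply: eq_bigr => a _; rewrite mulr_sumr.
have E2 : \sum_a \sum_b Z a b * Z b a = \tr (Z *m Z).
  by apply: eq_bigr => a _; rewrite mxE.
have E3 : \sum_(a < n) \sum_(b < n) Z b b = n%:R * \tr Z.
  by rewrite sumr_const card_ord mulr_natl.
have E4 : \sum_(a < n) \sum_(b < n) Z a a = n%:R * \tr Z by rewrite exchange_big E3.
have E : \sum_a \sum_b (2 * (Z a a * Z b b - Z a b * Z b a) - Z a a - Z b b) =
    2 * (\tr Z ^+ 2 - \tr (Z *m Z)) - n%:R * \tr Z - n%:R * \tr Z.
  rewrite -E1 -E2 -{1}E4 -E3 -!sumrB mulr_sumr -!sumrB; apply: eq_bigr => a _.
  by rewrite -!sumrB mulr_sumr -!sumrB.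
rewrite big_split E -mulr_sumr -/(\tr Z) /=; ring.
Qed.

Lemma sum_plane_antisym (F : comPzRingType) (n : nat) (Z W : 'M[F]_n) :
  \sum_a \sum_(b | b != a) (Z b a - Z a b) * (W b a - W a b) =
  2 * (\tr (Z *m W^T) - \tr (Z *m W)).
Proof.
transitivity (\sum_a \sum_b (Z b a - Z a b) * (W b a - W a b)).
  by apply: eq_bigr => a _; rewrite [RHS](bigD1 a)//= subrr mul0r add0r.
have E1 : \sum_a \sum_b Z a b * W a b = \tr (Z *m W^T).
  by apply: eq_bigr => a _; rewrite mxE; apply: eq_bigr => b _; rewrite mxE.
have E2 : \sum_a \sum_b Z a b * W b a = \tr (Z *m W).
  by apply: eq_bigr => a _; rewrite mxE.
transitivity (\sum_a \sum_b (Z b a * W b a + Z a b * W a b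
   - Z b a * W a b - Z a b * W b a)).
  by apply: eq_bigr => a _; apply: eq_bigr => b _; ring.
under eq_bigr => a _ do rewrite !(sumrB, big_split) /=.
rewrite !(sumrB, big_split) /= E1 E2 exchange_big /= E1 [X in _ - X - _]exchange_big /= E2.
ring.
Qed.

(** A row vector [v] killed by [x + g] satisfies [x v = - v g]; as [g] preserves norms and
    [x ^ 2 < 1], it vanishes. *)
Lemma orth_add_scalar_unit (R : realFieldType) (n : nat) (g : 'M[R]_n) (x : R) :
  g *m g^T = 1%:M -> 0 < x < 1 -> x%:M + g \in unitmx.
Proof.
move=> gg /andP[x0 x1]; rewrite -row_free_unit; apply: inj_row_free => v.
rewrite mulmxDr mul_mx_scalar => /eqP; rewrite addr_eq0 => /eqP e.
have : (x *: v) *m (x *: v)^T = v *m v^T.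
  by rewrite e linearN /= trmx_mul mulmxN mulNmx opprK mulmxA -(mulmxA v) gg mulmx1.
move=> /(congr1 (fun X : 'M[R]_1 => X 0 0)).
rewrite linearZ /= -scalemxAl -scalemxAr scalerA mxE.
have -> : (v *m v^T) 0 0 = \sum_i v 0 i ^+ 2.
  by rewrite mxE; apply: eq_bigr => i _; rewrite mxE expr2.
set S := \sum_i _ => xS.
have /eqP : (1 - x * x) * S = 0 by rewrite mulrBl mul1r xS subrr.
rewrite mulf_eq0 gt_eqF /= => [/eqP S0|]; last by rewrite subr_gt0 mulr_ilt1// ltW.
apply/rowP => i; rewrite mxE; apply/eqP; rewrite -sqrf_eq0; apply/eqP.
apply: (psumr_eq0P _ S0) => // j _; exact: sqr_ge0.
Qed.

End Rotation.

(** * Palindromic characteristic polynomials *)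

Section CharPoly.

(** The sample points are positive, so that identities valid for [x != 0] suffice. *)
Lemma poly_eq_nat (F : numDomainType) (p q : {poly F}) :
  (forall m : nat, p.[m.+1%:R] = q.[m.+1%:R]) -> p = q.
Proof.
move=> e; apply/eqP; rewrite -subr_eq0; apply: contraT => d0.
pose rs := [seq m.+1%:R | m <- iota 0 (size (p - q))] : seq F.
have urs : uniq rs.
  by rewrite map_inj_uniq ?iota_uniq// => a b /eqP; rewrite eqr_nat eqSS => /eqP.
have ars : all (root (p - q)) rs.
  by apply/allP => _ /mapP[m _ ->]; rewrite rootE hornerD hornerN e subrr.
by have := max_poly_roots d0 ars urs; rewrite size_map size_iota ltnn.
Qed.

(** [x + g = (x (1 / x + g))^T g], and [g] has determinant 1. *)
Lemma det_add_scalar_rev (F : fieldType) (n : nat) (g : 'M[F]_n) (x : F) :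
    g^T *m g = 1%:M -> \det g = 1 -> x != 0 ->
  \det (x%:M + g) = x ^+ n * \det ((x^-1)%:M + g).
Proof.
move=> gg dg x0; rewrite -detZ -[in RHS]det_tr.
have -> : x%:M + g = (x *: ((x^-1)%:M + g))^T *m g.
  rewrite linearZ /= linearD /= tr_scalar_mx scalerDr scale_scalar_mx divff//.
  by rewrite mulmxDl mul1mx -scalemxAl gg scalemx1 addrC.
by rewrite det_mulmx dg mulr1.
Qed.

Lemma det_1_addZ (F : comPzRingType) (n : nat) (g : 'M[F]_n) (x : F) :
    g^T *m g = 1%:M -> \det g = 1 ->
  \det (1%:M + x *: g) = \det (x%:M + g).
Proof.
move=> gg dg; rewrite -[RHS]det_tr linearD /= tr_scalar_mx.
have -> : 1%:M + x *: g = (x%:M + g^T) *m g.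
  by rewrite mulmxDl gg mul_scalar_mx addrC.
by rewrite det_mulmx dg mulr1.
Qed.

Lemma char_polyN_rev (F : numFieldType) (n : nat) (g : 'M[F]_n) (i : nat) :
    g^T *m g = 1%:M -> \det g = 1 -> (i <= n)%N ->
  (char_poly (- g))`_i = (char_poly (- g))`_(n - i).
Proof.
move=> gg dg le_in; set p := char_poly (- g).
have {1}-> : p = \poly_(l < n.+1) p`_(n - l).
  apply: poly_eq_nat => m; set x : F := m.+1%:R.
  have x0 : x != 0 by rewrite pnatr_eq0.
  rewrite /p horner_char_polyN (det_add_scalar_rev gg dg x0) -horner_char_polyN -/p.
  rewrite (@horner_coef_wide _ n.+1) ?size_char_poly// horner_poly mulr_sumr.
  rewrite [RHS](reindex_inj rev_ord_inj) /=; apply: eq_bigr => l _.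
  have ln : (l <= n)%N by rewrite -ltnS.
  rewrite subSS subKn// mulrCA; congr (_ * _).
  by rewrite exprVn -{1}(subnK ln) exprD mulfK// expf_neq0.
by rewrite coef_poly ltnS le_in.
Qed.

(* Halved at [l = 0] because [cheb F 0 = 2]. *)
Definition fcoef (F : fieldType) (N : nat) (p : {poly F}) (l : nat) : F :=
  if l == 0%N then p`_N / 2 else p`_(N + l).

Lemma palindrome_expand (F : numFieldType) (N : nat) (p : {poly F}) :
    (size p <= (2 * N).+1)%N ->
    (forall i, (i <= 2 * N)%N -> p`_i = p`_(2 * N - i)) ->
  p = \sum_(l < N.+1) fcoef N p l *: ('X^(N + l) + 'X^(N - l)).
Proof.
move=> sp pal; apply/polyP => i; rewrite coef_sum.
under eq_bigr => l _ do rewrite coefZ coefD !coefXn.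
have [lt|gt|e] := ltngtP i N.
- have lt1 : (N - i < N.+1)%N by lia.
  rewrite (bigD1 (Ordinal lt1))//= big1 ?addr0 => [|l /eqP nl].
    rewrite /fcoef; have -> : (N - i == 0)%N = false by apply/eqP; lia.
    have -> : (i == N + (N - i))%N = false by apply/eqP; lia.
    have -> : (i == N - (N - i))%N by apply/eqP; lia.
    by rewrite add0r mulr1 pal; [congr (p`_ _); lia|lia].
  have ll := ltn_ord l.
  have -> : (i == N + l)%N = false by apply/eqP; lia.
  case: eqP => [e|_]; last by rewrite addr0 mulr0.
  by case: nl; apply: val_inj => /=; lia.
- have [gt2|le2] := ltnP (2 * N) i.
    rewrite nth_default; last exact: leq_trans sp gt2.
    rewrite big1// => l _; have ll := ltn_ord l.
    have -> : (i == N + l)%N = false by apply/eqP; lia.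
    have -> : (i == N - l)%N = false by apply/eqP; lia.
    by rewrite addr0 mulr0.
  have lt1 : (i - N < N.+1)%N by lia.
  rewrite (bigD1 (Ordinal lt1))//= big1 ?addr0 => [|l /eqP nl].
    rewrite /fcoef; have -> : (i - N == 0)%N = false by apply/eqP; lia.
    have -> : (i == N + (i - N))%N by apply/eqP; lia.
    have -> : (i == N - (i - N))%N = false by apply/eqP; lia.
    by rewrite addr0 mulr1; congr (p`_ _); lia.
  have ll := ltn_ord l.
  have -> : (i == N - l)%N = false by apply/eqP; lia.
  case: eqP => [e|_]; last by rewrite addr0 mulr0.
  by case: nl; apply: val_inj => /=; lia.
rewrite e (bigD1 ord0)//= big1 ?addr0 => [|l l0].
  by rewrite addn0 subn0 eqxx -natrD divfK// pnatr_eq0.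
have : (0 < l)%N by rewrite lt0n.
move=> l1; have ll := ltn_ord l.
have -> : (N == N + l)%N = false by apply/eqP; lia.
have -> : (N == N - l)%N = false by apply/eqP; lia.
by rewrite addr0 mulr0.
Qed.

Section Derivatives.
Variables (F : numFieldType) (N : nat) (p : {poly F}) (x : F).
Hypothesis sp : (size p <= (2 * N).+1)%N.
Hypothesis pal : forall i, (i <= 2 * N)%N -> p`_i = p`_(2 * N - i).
Hypothesis x0 : x != 0.
Hypothesis x1 : x - x^-1 != 0.

Let phi : {poly F} := cheb_sum N (fcoef N p).
Let y : F := x + x^-1.

Lemma horner_deriv_cheb (m : nat) :
  (x - x^-1) * (cheb F m)^`().[y] = m%:R * (x ^+ m - x ^- m).
Proof.
have [/(congr1 (fun q : {poly F} => q.[y])) + _] := deriv_cheb F m.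
rewrite !hornerM !hornerD !hornerN !hornerM -!polyC_natr !hornerC hornerX.
rewrite ?hornerXn !horner_cheb// /tau !exprS => e.
apply: (mulfI x1); rewrite mulrA.
have -> : (x - x^-1) * (x - x^-1) = y * y - 4 by rewrite /y; field.
rewrite -expr2 e /y; field; by rewrite x0 expf_neq0.
Qed.

Lemma expr_subE (l : 'I_N.+1) : x ^+ (N - l) = x ^+ N * x ^- l.
Proof.
have ll : (l <= N)%N by rewrite -ltnS.
apply: (canRL (mulfK _)); first by rewrite expf_neq0.
by rewrite -exprD subnK.
Qed.

Lemma horner_palindrome : p.[x] = x ^+ N * phi.[y].
Proof.
rewrite (palindrome_expand sp pal) horner_sum horner_cheb_sum// mulr_sumr.
apply: eq_bigr => l _.
by rewrite hornerZ hornerD !hornerXn mulrCA expr_subE exprD -mulrDr.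
Qed.

Lemma horner_derivXn (m : nat) : x * ('X^m)^`().[x] = m%:R * x ^+ m.
Proof.
rewrite derivXn hornerMn hornerXn; case: m => [|m]; first by rewrite mulr0n mulr0 mul0r.
by rewrite mulrnAr -exprS mulr_natl.
Qed.

Lemma horner_deriv2Xn (m : nat) :
  x ^+ 2 * ('X^m)^`()^`().[x] + x * ('X^m)^`().[x] = (m%:R) ^+ 2 * x ^+ m.
Proof.
case: m => [|m]; first by rewrite expr0 derivC derivC horner0 !mulr0 addr0 expr0n mul0r.
have e := horner_derivXn m.
rewrite derivXn /= derivMn !hornerMn hornerXn -(mulr_natl _^`().[x]) -(mulr_natl (x ^+ m)).
transitivity (m.+1%:R * x * (x * ('X^m)^`().[x]) + m.+1%:R * (x * x ^+ m)); first by ring.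
rewrite e -exprS [x ^+ m.+1]exprS -natr1; ring.
Qed.

Lemma deriv_palindrome :
  x * p^`().[x] = x ^+ N * (N%:R * phi.[y] + (x - x^-1) * phi^`().[y]).
Proof.
rewrite {1}(palindrome_expand sp pal) raddf_sum /= horner_sum mulr_sumr.
have -> : phi^`().[y] = \sum_(l < N.+1) fcoef N p l * (cheb F l)^`().[y].
  by rewrite raddf_sum horner_sum; apply: eq_bigr => l _; rewrite /= derivZ hornerZ.
rewrite horner_cheb_sum// !mulr_sumr -big_split /= mulr_sumr; apply: eq_bigr => l _.
rewrite derivZ hornerZ derivD hornerD mulrCA mulrDr !horner_derivXn.
rewrite [(x - _) * _]mulrCA horner_deriv_cheb expr_subE exprD /tau.
have ll : (l <= N)%N by rewrite -ltnS.
rewrite natrD natrB//; ring.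
Qed.

(** The left side is [(x d/dx) ^ 2] applied to [x ^ N phi (y)]. On functions of [y], [x d/dx] acts
    as [(x - 1 / x) d/dy], whose square is [cheb_op]; the identity is checked on each pair of
    monomials. *)
Lemma deriv2_palindrome :
  x ^+ 2 * p^`()^`().[x] + x * p^`().[x] = x ^+ N *
   (N%:R ^+ 2 * phi.[y] + 2 * N%:R * (x - x^-1) * phi^`().[y] + (cheb_op phi).[y]).
Proof.
have -> : phi^`().[y] = \sum_(l < N.+1) fcoef N p l * (cheb F l)^`().[y].
  by rewrite raddf_sum horner_sum; apply: eq_bigr => l _; rewrite /= derivZ hornerZ.
have -> : (cheb_op phi).[y] = \sum_(l < N.+1) fcoef N p l * (l%:R ^+ 2 * tau l x).
  rewrite cheb_op_sum horner_sum; apply: eq_bigr => l _.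
  by rewrite hornerZ /cheb_op cheb_ode hornerM horner_cheb// -polyC_natr hornerC natrX.
rewrite horner_cheb_sum// {1 2}(palindrome_expand sp pal) !raddf_sum /= !horner_sum.
rewrite !mulr_sumr -!big_split /= mulr_sumr; apply: eq_bigr => l _.
rewrite !derivZ !hornerZ !derivD !hornerD.
transitivity (fcoef N p l * ((x ^+ 2 * ('X^(N + l))^`()^`().[x] + x * ('X^(N + l))^`().[x])
  + (x ^+ 2 * ('X^(N - l))^`()^`().[x] + x * ('X^(N - l))^`().[x]))); first by ring.
rewrite !horner_deriv2Xn expr_subE exprD.
have -> : 2 * N%:R * (x - x^-1) * (fcoef N p l * (cheb F l)^`().[y]) =
  2 * N%:R * fcoef N p l * ((x - x^-1) * (cheb F l)^`().[y]) by ring.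
have ll : (l <= N)%N by rewrite -ltnS.
rewrite horner_deriv_cheb /tau natrD natrB//; ring.
Qed.

End Derivatives.

End CharPoly.

(** * From resolvent traces to the operator in the variables [y_j] *)

Section Bracket.

Lemma sum_sqr_shift (F : comNzRingType) (N k : nat) :
  (\sum_(i < k) (N + i) ^ 2)%:R =
  k%:R * N%:R ^+ 2 + k%:R * (k%:R - 1) * N%:R + (\sum_(i < k) i ^ 2)%:R :> F.
Proof.
elim: k => [|k IHk]; first by rewrite !big_ord0 !mul0r !add0r.
rewrite !big_ord_recr /= !natrD IHk !natrX !natrD -natr1; ring.
Qed.

Variables (R : realFieldType) (N k : nat) (g : 'M[R]_(2 * N)) (x : 'I_k -> R).
Hypotheses (gg : g^T *m g = 1%:M) (dg : \det g = 1).
Hypotheses (x01 : forall j, 0 < x j < 1) (xI : injective x).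

Let p := char_poly (- g).
Let f := fcoef N p.
Let phi := cheb_sum N f.
Let y j := x j + (x j)^-1.
Let Z j := resolvent g (x j).
Let t j := \tr (Z j).
Let w j := phi^`().[y j] / phi.[y j].

Let x0 j : x j != 0.
Proof. by case/andP: (x01 j) => /gt_eqF ->. Qed.

Let x1 j : x j - (x j)^-1 != 0.
Proof.
have /andP[xp xl] := x01 j; rewrite subr_eq0 lt_eqF// (lt_trans xl)//.
by rewrite invf_gt1.
Qed.

Let xu j : (x j)%:M + g \in unitmx.
Proof. by apply: orth_add_scalar_unit => //; exact: mulmx1C. Qed.

Let sp : (size p <= (2 * N).+1)%N.
Proof. by rewrite size_char_poly. Qed.

Let pal i : (i <= 2 * N)%N -> p`_i = p`_(2 * N - i).
Proof. exact: char_polyN_rev. Qed.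

Let p0 j : p.[x j] != 0.
Proof. by rewrite horner_char_polyN -unitfE -unitmxE. Qed.

Let pE j : p.[x j] = x j ^+ N * phi.[y j].
Proof. exact: horner_palindrome. Qed.

Let phi0 j : phi.[y j] != 0.
Proof. by have := p0 j; rewrite pE mulf_eq0 => /norP[]. Qed.

Let tE j : t j = N%:R + (x j - (x j)^-1) * w j.
Proof.
apply: (mulfI (p0 j)); rewrite -(deriv1_char_polyN (xu j)).
have -> : x j * p^`().[x j] = x j ^+ N *
    (N%:R * phi.[y j] + (x j - (x j)^-1) * phi^`().[y j]) by exact: deriv_palindrome.
rewrite pE -[RHS]mulrA /w; congr (_ * _); move: (phi0 j) (x0 j).
  by move: phi.[y j] phi^`().[y j] (cheb_op phi).[y j] (x j) => A B C z A0 z0; field; rewrite ?A0 ?z0.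
Qed.

(** [t ^ 2 - \tr (Z ^ 2) + t] is [(x d/dx) ^ 2 p / p]; subtracting [2 N t] cancels the term in [w]
    and turns [N ^ 2] into [- N ^ 2]. *)
Let t2E j : t j ^+ 2 - \tr (Z j *m Z j) - ((2 * N)%:R - 1) * t j =
  (cheb_op phi).[y j] / phi.[y j] - N%:R ^+ 2.
Proof.
have e : t j ^+ 2 - \tr (Z j *m Z j) + t j = N%:R ^+ 2 +
    2 * N%:R * (x j - (x j)^-1) * w j + (cheb_op phi).[y j] / phi.[y j].
  apply: (mulfI (p0 j)); rewrite mulrDr -(deriv1_char_polyN (xu j)).
  rewrite -(deriv2_char_polyN (xu j)).
  have -> : x j ^+ 2 * p^`()^`().[x j] + x j * p^`().[x j] = x j ^+ N *
      (N%:R ^+ 2 * phi.[y j] + 2 * N%:R * (x j - (x j)^-1) * phi^`().[y j]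
       + (cheb_op phi).[y j]) by exact: deriv2_palindrome.
  rewrite pE -[RHS]mulrA /w; congr (_ * _); move: (phi0 j) (x0 j).
  by move: phi.[y j] phi^`().[y j] (cheb_op phi).[y j] (x j) => A B C z A0 z0; field; rewrite ?A0 ?z0.
transitivity (t j ^+ 2 - \tr (Z j *m Z j) + t j - 2 * N%:R * t j).
  by rewrite natrM; ring.
by rewrite e tE; ring.
Qed.

Let sum_yj i j : i != j -> y j - y i != 0.
Proof.
move=> ij; rewrite /y subr_addV// mulf_neq0//.
  by rewrite subr_eq0 (inj_eq xI) eq_sym.
rewrite subr_eq0 eq_sym -invfM invr_eq1 lt_eqF//.
by have /andP[? ?] := x01 i; have /andP[? ?] := x01 j; rewrite mulr_ilt1// ltW.
Qed.

(** The resolvent identities leave only [t i] and [t j], and their denominators [x j - x i] and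
    [1 - x j * x i] combine into [y j - y i]. *)
Let pairE i j : i != j ->
  \tr (Z j *m (Z i)^T) - \tr (Z j *m Z i) =
  ((y j ^+ 2 - 4) * w j - (y i ^+ 2 - 4) * w i) / (y j - y i) - N%:R.
Proof.
move=> ij; have xij : x j - x i != 0 by rewrite subr_eq0 (inj_eq xI) eq_sym.
have xx1 : 1 - x j * x i != 0.
  rewrite subr_eq0 eq_sym lt_eqF//.
  by have /andP[? ?] := x01 i; have /andP[? ?] := x01 j; rewrite mulr_ilt1// ltW.
have e1 : \tr (Z j *m Z i) = (x j * t i - x i * t j) / (x j - x i).
  apply: (canRL (mulfK xij)); rewrite mulrC -mxtraceZ resolvent_mul//.
  by rewrite raddfB; congr (_ - _); exact: mxtraceZ.
have e2 : \tr (Z j *m (Z i)^T) = x j * x i * ((2 * N)%:R - t j - t i) / (1 - x j * x i).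
  apply: (canRL (mulfK xx1)); rewrite mulrC -mxtraceZ resolvent_mul_tr//; last exact: mulmx1C.
  by rewrite mxtraceZ !raddfB /= mxtrace1 mxtrace_tr.
rewrite e1 e2 !tE natrM /y.
have yij := sum_yj ij; have := x0 i; have := x0 j.
rewrite /y in yij.
have yE : x j + (x j)^-1 - (x i + (x i)^-1) = (x j - x i) * (x j * x i - 1) / (x j * x i).
  by field; rewrite !x0.
have sq (z : R) : z != 0 -> (z + z^-1) ^+ 2 - 4 = (z - z^-1) ^+ 2 by move=> z0; field.
rewrite !sq// yE => xj0 xi0; field.
by rewrite xi0 xj0 xij xx1 -oppr_eq0 opprB xx1.
Qed.

(** Given [slater_eigen], only constants remain to be matched: [- k N ^ 2] from [t2E],
    [- k (k - 1) N] from [pairE], and the sum of the [i ^ 2]; [sum_sqr_shift] does this. *)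
Lemma bracket_eq :
  (\prod_j p.[x j]) * \det (\matrix_(i < k, j < k) tau i (x j)) *
  (\sum_j (t j ^+ 2 - \tr (Z j *m Z j) - ((2 * N)%:R - 1) * t j) +
   \sum_j \sum_(i | i != j) (\tr (Z j *m (Z i)^T) - \tr (Z j *m Z i))) =
  (\prod_j x j) ^+ N *
  \sum_(a : {ffun 'I_k -> 'I_(N + k)})
    ((\sum_j (a j) ^ 2)%:R - (\sum_(i < k) (N + i) ^ 2)%:R) *
    (\prod_j tau (a j) (x j) * dcoef f a).
Proof.
have yI : injective y.
  move=> i j /eqP; apply: contraTeq => ij; rewrite -subr_eq0.
  by rewrite eq_sym in ij; exact: sum_yj ij.
rewrite (eq_bigr _ (fun j _ => pE j)) big_split /= prodrXl -!mulrA; congr (_ * _).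
under [RHS]eq_bigr => a _ do rewrite mulrBl.
rewrite [RHS]sumrB (slater_eigen x0 yI phi0) -mulr_sumr -slater_expand//.
have -> : \prod_j (\sum_(l < N.+1) f l * tau l (x j)) = \prod_j phi.[y j].
  by apply: eq_bigr => j _; rewrite horner_cheb_sum.
set V := \det _; rewrite (eq_bigr _ (fun j _ => t2E j)) sumrB sumr_const card_ord.
pose E j := (y j ^+ 2 - 4) * w j.
(* Exchanging [i] and [j] shows that the two halves of [(E j - E i) / (y j - y i)] have equal
   sums. *)
have -> : \sum_j \sum_(i | i != j) (\tr (Z j *m (Z i)^T) - \tr (Z j *m Z i)) =
    2 * (\sum_j \sum_(i | i != j) E j / (y j - y i)) - k%:R * (k%:R - 1) * N%:R.
  transitivity (\sum_j (\sum_(i | i != j) E j / (y j - y i)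
      + \sum_(i | i != j) E i / (y i - y j) - (k%:R - 1) * N%:R)).
    apply: eq_bigr => j _; rewrite -big_split /=.
    have -> : (k%:R - 1) * N%:R = \sum_(i < k | i != j) (N%:R : R).
      rewrite sumr_const cardC1 card_ord -[RHS]mulr_natl; congr (_ * _).
      by case: (k) j => [[]//|k' _]; rewrite -natr1 addrK.
    rewrite -sumrB; apply: eq_bigr => i ij; rewrite pairE//; congr (_ - _).
    by rewrite /E mulrBl -[y i - y j]opprB invrN mulrN.
  rewrite sumrB big_split /= sumr_const card_ord -(mulr_natl ((k%:R - 1) * N%:R) k) mulrA; congr (_ - _).
  rewrite [X in _ + X = _](_ : _ = \sum_j \sum_(i | i != j) E j / (y j - y i)).
    by ring.
  rewrite [LHS](exchange_big_dep xpredT)//=; apply: eq_bigr => j _.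
  by apply: eq_bigl => i; rewrite eq_sym.
rewrite sum_sqr_shift -(mulr_natl (N%:R ^+ 2) k); ring.
Qed.

End Bracket.
(** * Integration over SO(n) *)

Section Expectation.
Local Open Scope classical_set_scope.
Variables (R : realType) (n : nat).
Local Notation G := (SO R n).

Lemma mx_of_SO_continuous : continuous (@mx_of_SO R n).
Proof. exact: initial_continuous. Qed.

Lemma continuous_SO_measurable (f : G -> R) :
  continuous f -> measurable_fun setT f.
Proof.
move=> /continuousP cf; apply: (measurability _ (RGenOpens.measurableE R)).
move=> _ [_ [a [b ->] <-]]; rewrite setTI; apply: sub_sigma_algebra.
by apply: cf; exact: interval_open.
Qed.

Lemma continuous_SO_mull (h : G) : continuous (fun g : G => (h * g)%g).
Proof.
(* The topology of [SO] is initial, so continuity can be tested on matrices, and there entry by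
   entry. *)
suff /continuousP c : continuous (fun g : G => val h *m mx_of_SO g).
  by apply/continuousP => _ [B oB <-]; exact: c.
move=> g A [P hP sPA].
have cE i j : continuous (fun g' : G => (val h *m mx_of_SO g') i j).
  have -> : (fun g' : G => (val h *m mx_of_SO g') i j) =
      (fun g' : G => \sum_l val h i l * mx_of_SO g' l j).
    by apply/funext => g'; rewrite mxE.
  apply: continuous_big => [|l _ g']; first exact: add_continuous.
  apply: (@continuous_comp _ _ _ (@mx_of_SO R n) (fun M : 'M[R]_n => val h i l * M l j)).
    exact: mx_of_SO_continuous.
  apply: (@continuous_comp _ _ _ (fun M : 'M[R]_n => M l j) ( *%R (val h i l))).
    exact: coord_continuous.
  exact: mulrl_continuous.
have : \forall g' \near g, forall i j, P i j ((val h *m mx_of_SO g') i j).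
  have FF : Filter (nbhs g) by exact: nbhs_filter.
  apply: (@filter_forall _ _ _ _ FF) => i; apply: (@filter_forall _ _ _ _ FF) => j.
  exact: (cE i j g (P i j) (hP i j)).
by apply: filterS => g' hg'; apply: sPA => i j; exact: hg'.
Qed.

Lemma measurable_SO_mull (h : G) : measurable_fun setT (fun g : G => (h * g)%g).
Proof.
apply: (@measurability _ _ _ _ _ _ (@open G)) => //.
move=> _ [B oB <-]; rewrite setTI; apply: sub_sigma_algebra.
by move/continuousP: (@continuous_SO_mull h); apply.
Qed.

(** A class stable under sums, products and left translations, and integrable for every
    probability. *)
Definition nice (f : G -> R) : Prop :=
  measurable_fun setT f /\ exists M, forall g, `|f g| <= M.

Lemma nice_cst c : nice (fun=> c).
Proof. by split; [exact: measurable_cst | exists `|c|]. Qed.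

Lemma niceD f1 f2 : nice f1 -> nice f2 -> nice (fun g => f1 g + f2 g).
Proof.
move=> [m1 [M1 b1]] [m2 [M2 b2]]; split; first exact: measurable_funD.
by exists (M1 + M2) => g; rewrite (le_trans (ler_normD _ _))// lerD.
Qed.

Lemma niceM f1 f2 : nice f1 -> nice f2 -> nice (fun g => f1 g * f2 g).
Proof.
move=> [m1 [M1 b1]] [m2 [M2 b2]]; split; first exact: measurable_funM.
by exists (M1 * M2) => g; rewrite normrM ler_pM.
Qed.

Lemma nice_sum (I : Type) (r : seq I) (P : pred I) (F : I -> G -> R) :
  (forall i, nice (F i)) -> nice (fun g => \sum_(i <- r | P i) F i g).
Proof.
move=> nF; elim: r => [|i r IHr].
  by rewrite (_ : (fun _ => _) = fun=> 0); [exact: nice_cst | apply/funext => g; rewrite big_nil].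
rewrite (_ : (fun _ => _) = fun g => (if P i then F i g else 0) +
    \sum_(i <- r | P i) F i g); last first.
  by apply/funext => g; rewrite big_cons; case: (P i); rewrite ?add0r.
by apply: niceD => //; case: (P i) => //; exact: nice_cst.
Qed.

Lemma nice_prod (I : Type) (r : seq I) (F : I -> G -> R) :
  (forall i, nice (F i)) -> nice (fun g => \prod_(i <- r) F i g).
Proof.
move=> nF; elim: r => [|i r IHr].
  by rewrite (_ : (fun _ => _) = fun=> 1); [exact: nice_cst | apply/funext => g; rewrite big_nil].
rewrite (_ : (fun _ => _) = fun g => F i g * \prod_(i <- r) F i g); last first.
  by apply/funext => g; rewrite big_cons.
exact: niceM.
Qed.

Lemma nice_det (m : nat) (F : 'I_m -> 'I_m -> G -> R) :
  (forall i j, nice (F i j)) -> nice (fun g => \det (\matrix_(i, j) F i j g)).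
Proof.
move=> nF; rewrite /determinant.
apply: nice_sum => s; apply: niceM; first exact: nice_cst.
rewrite (_ : (fun _ => _) = fun g => \prod_i F i (s i) g); last first.
  by apply/funext => g; apply: eq_bigr => i _; rewrite mxE.
exact: nice_prod.
Qed.

Lemma nice_mull (h : G) f : nice f -> nice (fun g => f (h * g)%g).
Proof.
move=> [mf [M bM]]; split; last by exists M => g; exact: bM.
exact: (measurableT_comp mf (measurable_SO_mull h)).
Qed.

Lemma nice_entry i j : nice (fun g : G => mx_of_SO g i j).
Proof.
split.
  apply: continuous_SO_measurable => g.
  apply: (@continuous_comp _ _ _ (@mx_of_SO R n) (fun M : 'M[R]_n => M i j)).
    exact: mx_of_SO_continuous.
  exact: coord_continuous.
(* The columns of an orthogonal matrix are unit vectors. *)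
exists (1 : R) => g; have [gg _] := set_mem (valP g).
have := congr1 (fun X : 'M[R]_n => X j j) gg; rewrite !mxE eqxx mulr1n (bigD1 i)//= mxE => e.
rewrite -(@ler_sqr R _ 1) ?nnegrE// expr1n -normrX ger0_norm ?sqr_ge0// -e expr2.
by rewrite lerDl sumr_ge0// => l _; rewrite mxE -expr2 sqr_ge0.
Qed.

Variable mu : probability G R.

Definition expect (f : G -> R) : R := \int[mu]_g f g.

Lemma nice_integrable f : nice f -> mu.-integrable setT (EFin \o f).
Proof.
move=> [mf [M bM]]; apply: measurable_bounded_integrable => //.
  exact: (le_lt_trans (probability_le1 mu measurableT) (ltry _)).
exists M; split; first exact: num_real.
by move=> x Mx g _; exact: le_trans (bM g) (ltW Mx).
Qed.

Lemma expect_cst c : expect (fun=> c) = c.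
Proof.
rewrite /expect Rintegral_cst//.
rewrite -[RHS]mulr1; congr (_ * _); rewrite -[RHS]/(fine 1%E); congr fine.
exact: (probability_setT mu).
Qed.

Lemma expectD f1 f2 : nice f1 -> nice f2 ->
  expect (fun g => f1 g + f2 g) = expect f1 + expect f2.
Proof. by move=> n1 n2; apply: RintegralD => //; exact: nice_integrable. Qed.

Lemma expectZ c f : nice f -> expect (fun g => c * f g) = c * expect f.
Proof. by move=> nf; apply: RintegralZl => //; exact: nice_integrable. Qed.

Lemma expect_sum (I : Type) (r : seq I) (F : I -> G -> R) :
    (forall i, nice (F i)) ->
  expect (fun g => \sum_(i <- r) F i g) = \sum_(i <- r) expect (F i).
Proof.
move=> nF; elim: r => [|i r IHr].
  rewrite big_nil -[RHS](expect_cst 0); congr expect.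
  by apply/funext => g; rewrite big_nil.
rewrite big_cons -IHr -expectD//; last exact: nice_sum.
by congr expect; apply/funext => g; rewrite big_cons.
Qed.

Hypothesis hmu : is_haar mu.

Lemma expect_mull (h : G) f : nice f -> expect (fun g => f (h * g)%g) = expect f.
Proof.
move=> nf; rewrite /expect /Rintegral; congr fine.
have nfh := nice_mull h nf.
have mf : measurable_fun setT (EFin \o f) by apply/measurable_EFinP; exact: nf.1.
have /= := @integral_pushforward _ _ _ _ _ _ (measurable_SO_mull h) mu setT
  (EFin \o f) mf (nice_integrable nfh) measurableT.
rewrite preimage_setT => <-.
apply: eq_measure_integral => [|? A mA _]; first exact: measurable_SO_mull.
(* [is_haar] concerns images: the preimage of [A] under translation by [h] is its image under
   translation by [h^-1]. *)
apply: (etrans _ (hmu h^-1%g mA)); rewrite /= /pushforward; congr (mu _).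
apply/seteqP; split => g /=.
  by move=> Ahg; exists (h * g)%g => //; rewrite mulKg.
by move=> [g' Ag' <-]; rewrite mulVKg.
Qed.

End Expectation.

(** * Invariance under plane rotations to second order *)

Section PolyCoef.

(** The last term is the second elementary symmetric function of the [b j]; the induction also
    carries the coefficients of degree 0 and 1. *)
Lemma coef2_prod (F : numFieldType) (k : nat) (b c : 'I_k -> F) :
  (\prod_j (1 + (b j)%:P * 'X + (c j)%:P * 'X^2))`_2 =
  \sum_j c j + ((\sum_j b j) ^+ 2 - \sum_j b j ^+ 2) / 2.
Proof.
suff [_ _ ->] : [/\ (\prod_j (1 + (b j)%:P * 'X + (c j)%:P * 'X^2))`_0 = 1,
    (\prod_j (1 + (b j)%:P * 'X + (c j)%:P * 'X^2))`_1 = \sum_j b j &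
    (\prod_j (1 + (b j)%:P * 'X + (c j)%:P * 'X^2))`_2 =
      \sum_j c j + ((\sum_j b j) ^+ 2 - \sum_j b j ^+ 2) / 2] by [].
elim: (index_enum _) => [|j r [IH0 IH1 IH2]].
  by rewrite !big_nil !coefC /=; split=> //; rewrite expr0n subrr mul0r addr0.
rewrite !big_cons; set q := \prod_(i <- r) _ in IH0 IH1 IH2 *.
have E : (1 + (b j)%:P * 'X + (c j)%:P * 'X^2) * q =
  q + b j *: (q * 'X) + c j *: (q * 'X^2) by rewrite -!mul_polyC; ring.
rewrite E !coefD !coefZ !coefMX !coefMXn /= IH0 IH1 IH2 !mulr0 !addr0 mulr1.
by split=> //; [rewrite addrC|field].
Qed.

End PolyCoef.

Section Haar.
Variables (R : realType) (n : nat).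
Local Notation G := (SO R n).

Lemma nice_eq (f1 f2 : G -> R) : f1 =1 f2 -> nice f1 -> nice f2.
Proof. by move=> /funext ->. Qed.

(** Inverting a Vandermonde matrix writes each coefficient as a fixed combination of values.
    Derivatives can then be read as coefficients, with no differentiation under the integral. *)
Lemma nice_coef (d : nat) (P : G -> {poly R}) :
    (forall g, size (P g) <= d)%N -> (forall z, nice (fun g => (P g).[z])) ->
  forall i, nice (fun g => (P g)`_i).
Proof.
move=> sP nP i; have [di|lt_id] := leqP d i.
  apply: (nice_eq _ (nice_cst n 0)) => g.
  by rewrite nth_default// (leq_trans (sP g)).
pose a := \row_(s < d) (s%:R : R); pose V := Vandermonde d a.
have Vu : V \in unitmx.
  rewrite unitmxE unitfE det_Vandermonde; apply/prodf_neq0 => s _.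
  apply/prodf_neq0 => s' ss'; rewrite !mxE subr_eq0 eqr_nat.
  by rewrite neq_ltn ss' orbT.
apply: (@nice_eq (fun g => \sum_s (P g).[a 0 s] * invmx V s (Ordinal lt_id))).
  move=> g; pose c := \row_(m < d) (P g)`_m.
  have e : \row_s (P g).[a 0 s] = c *m V.
    apply/rowP => s; rewrite !mxE (@horner_coef_wide _ d)//.
    by apply: eq_bigr => m _; rewrite !mxE.
  have := congr1 (fun X : 'rV[R]_d => (X *m invmx V) 0 (Ordinal lt_id)) e.
  rewrite -mulmxA mulmxV// mulmx1 [c _ _]mxE => <-; rewrite mxE.
  by apply: eq_bigr => s _; rewrite !mxE.
by apply: nice_sum => s; apply: niceM => //; exact: nice_cst.
Qed.

Lemma mx_of_SOM (h g : G) : mx_of_SO (h * g)%g = mx_of_SO h *m mx_of_SO g.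
Proof. by []. Qed.

Lemma mx_of_SO_orth (g : G) : (mx_of_SO g)^T *m mx_of_SO g = 1%:M.
Proof. by have [] := set_mem (valP g). Qed.

Lemma mx_of_SO_det (g : G) : \det (mx_of_SO g) = 1.
Proof. by have [] := set_mem (valP g). Qed.

(** The transpose appears because [det (x + r^T g) = det (x r + g)] for a rotation [r], the form
    treated by [det_rotation_add]. *)
Lemma rotation_SO (s u : R) (a b : 'I_n) : s ^+ 2 + u ^+ 2 = 2 * u -> a != b ->
  exists h : G, mx_of_SO h = (rotation s u a b)^T.
Proof.
move=> su ab; have h : SO_mx (rotation s u a b)^T.
  by split; [rewrite trmxK; exact/mulmx1C/rotation_orth | rewrite det_tr det_rotation].
by exists (exist _ (rotation s u a b)^T (mem_set h) : G).
Qed.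

Definition cpoly (g : G) : {poly R} := char_poly (- mx_of_SO g).

Lemma nice_horner_cpoly z : nice (fun g => (cpoly g).[z]).
Proof.
apply: (@nice_eq (fun g => \det (\matrix_(i, j) ((z%:M : 'M[R]_n) i j + mx_of_SO g i j)))).
  move=> g; rewrite horner_char_polyN; congr (\det _).
  by apply/matrixP => i j; rewrite !mxE.
apply: nice_det => i j; apply: niceD; first exact: nice_cst.
exact: nice_entry.
Qed.

Lemma nice_cpoly_coef i : nice (fun g => (cpoly g)`_i).
Proof.
apply: (@nice_coef n.+1) => [g|]; first by rewrite size_char_poly.
exact: nice_horner_cpoly.
Qed.

Variables (mu : probability G R).
Hypothesis hmu : is_haar mu.
Variables (k : nat) (x : 'I_k -> R).
Hypothesis x01 : forall j, 0 < x j < 1.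

Let Z (g : G) j := resolvent (mx_of_SO g) (x j).
Let W (g : G) := \prod_j (cpoly g).[x j].

Let xu (g : G) j : (x j)%:M + mx_of_SO g \in unitmx.
Proof. by apply: orth_add_scalar_unit => //; exact/mulmx1C/mx_of_SO_orth. Qed.

Let kappa (a b : 'I_n) g j := Z g j b a - Z g j a b.
Let rho (a b : 'I_n) g j :=
  2 * (Z g j a a * Z g j b b - Z g j a b * Z g j b a) - Z g j a a - Z g j b b.

(** The second derivative at [t = 0] of [W] along the rotations by [t], divided by [W]: to second
    order [s = t] and [u = t ^ 2 / 2], so the factors are [1 + t kappa + t ^ 2 rho / 2]. *)
Let bracket a b g :=
  \sum_j rho a b g j + ((\sum_j kappa a b g j) ^+ 2 - \sum_j kappa a b g j ^+ 2).

Lemma expect_bracket (a b : 'I_n) : a != b ->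
  nice (fun g => W g * bracket a b g) /\
  expect mu (fun g => W g * bracket a b g) = 0.
Proof.
move=> ab; have nW : nice W by apply: nice_prod => j; exact: nice_horner_cpoly.
(* By the parametrization [s = 2 z / (1 + z ^ 2)], [u = 2 z ^ 2 / (1 + z ^ 2)]
   of the rotations, [(Pi g).[z] = (1 + z ^ 2) ^ k * W (h g)] for a rotation [h]
   depending on [z] only; its coefficient of [z ^ 2] carries the second
   derivative of [W] along the rotations. *)
pose Pi g : {poly R} := (W g) *: \prod_j (1 + (2 * kappa a b g j)%:P * 'X +
    (1 + 2 * rho a b g j)%:P * 'X^2).
have sPi g : (size (Pi g) <= (2 * k).+1)%N.
  apply: (leq_trans (size_scale_leq _ _)); apply: (leq_trans (size_prod_leq _ _)).
  rewrite cardE size_enum_ord; set S := (\sum_(_ | _) _)%N.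
  suff : (S <= 3 * k)%N by lia.
  rewrite mulnC -[X in (X * _)%N](card_ord k) -sum_nat_const; apply: leq_sum => j _.
  apply: (leq_trans (size_polyD _ _)); rewrite geq_max; apply/andP; split.
    apply: (leq_trans (size_polyD _ _)); rewrite geq_max size_poly1 /=.
    rewrite mul_polyC; apply: (leq_trans (size_scale_leq _ _)).
    by rewrite size_polyX.
  by rewrite mul_polyC; apply: (leq_trans (size_scale_leq _ _)); rewrite size_polyXn.
have PiE z : exists h : G, forall g, (Pi g).[z] = (1 + z ^+ 2) ^+ k * W (h * g)%g.
  have z0 : 1 + z ^+ 2 != 0 by rewrite gt_eqF// ltr_pwDl// sqr_ge0.
  pose s := 2 * z / (1 + z ^+ 2); pose u := 2 * z ^+ 2 / (1 + z ^+ 2).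
  have su : s ^+ 2 + u ^+ 2 = 2 * u by rewrite /s /u; field.
  have [h hE] := rotation_SO su ab; exists h => g.
  have cE j : (cpoly (h * g)%g).[x j] = (cpoly g).[x j] *
      (1 + s * kappa a b g j + u * rho a b g j).
    rewrite !horner_char_polyN -det_rotation_add// mx_of_SOM hE.
    rewrite -[LHS]mul1r -(det_rotation su ab) -det_mulmx mulmxDr.
    by rewrite mulmxA (mulmx1C (rotation_orth su ab)) mul1mx mul_mx_scalar.
  rewrite hornerZ horner_prod /W (eq_bigr _ (fun j _ => cE j)) [in RHS]big_split /=.
  rewrite mulrCA; congr (_ * _).
  have -> : (1 + z ^+ 2) ^+ k = \prod_(j < k) (1 + z ^+ 2).
    by rewrite prodr_const card_ord.
  rewrite -big_split; apply: eq_bigr => j _ /=.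
  rewrite !(hornerD, hornerM, hornerC, hornerX) /s /u; field.
  by rewrite ?z0.
have nPi z : nice (fun g => (Pi g).[z]).
  have [h hE] := PiE z; apply: (@nice_eq (fun g => (1 + z ^+ 2) ^+ k * W (h * g)%g)).
    by move=> g; rewrite hE.
  by apply: niceM; [exact: nice_cst | exact: nice_mull].
have nc := nice_coef sPi nPi.
pose Q := \poly_(i < (2 * k).+1) expect mu (fun g => (Pi g)`_i).
(* Invariance makes the expectation of [(Pi g).[z]] equal to [(1 + z ^ 2) ^ k] times that of [W];
   the product is written in the shape of [coef2_prod]. *)
have QE : Q = expect mu W *: (\prod_(j < k) (1 + 0%:P * 'X + 1%:P * 'X^2)).
  apply: poly_eq_nat => m; set z : R := m.+1%:R.
  rewrite horner_poly; transitivity (expect mu (fun g => (Pi g).[z])).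
    transitivity (expect mu (fun g => \sum_(i < (2 * k).+1) z ^+ i * (Pi g)`_i)).
      rewrite expect_sum => [|i]; last by apply: niceM => //; exact: nice_cst.
      by apply: eq_bigr => i _; rewrite expectZ// mulrC.
    congr (expect mu _); apply/funext => g; rewrite (horner_coef_wide _ (sPi g)).
    by apply: eq_bigr => i _; rewrite mulrC.
  have [h hE] := PiE z; transitivity (expect mu (fun g => (1 + z ^+ 2) ^+ k * W (h * g)%g)).
    by congr (expect mu _); apply/funext => g; rewrite hE.
  rewrite expectZ; last exact: nice_mull.
  rewrite expect_mull// hornerZ mulrC; congr (_ * _).
  rewrite horner_prod; under eq_bigr => j _ do
    rewrite !(hornerD, hornerM, hornerC, hornerX) mul0r addr0 mul1r -expr2.
  by rewrite prodr_const card_ord.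
have e2 : expect mu (fun g => (Pi g)`_2) = expect mu W * k%:R.
  (* For [k = 0], [Q] is truncated below degree 2 and says nothing about this coefficient. *)
  have [k0|k0] := posnP k.
    rewrite k0 mulr0 -[RHS](expect_cst mu 0); congr (expect mu _); apply/funext => g.
    by rewrite nth_default// (leq_trans (sPi g))// k0.
  have := congr1 (fun q : {poly R} => q`_2) QE; rewrite coef_poly.
  have -> : (2 < (2 * k).+1)%N by lia.
  move=> ->; rewrite coefZ coef2_prod; congr (_ * _).
  rewrite sumr_const card_ord !big1 => [|i _|i _] //; rewrite ?expr0n //=.
  by rewrite subrr mul0r addr0.
have Pi2 g : (Pi g)`_2 = k%:R * W g + 2 * (W g * bracket a b g).
  rewrite coefZ coef2_prod big_split /= sumr_const card_ord -!mulr_sumr.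
  have -> : \sum_j (2 * kappa a b g j) ^+ 2 = 4 * \sum_j kappa a b g j ^+ 2.
    by rewrite mulr_sumr; apply: eq_bigr => j _; ring.
  by rewrite /bracket; field.
have bE g : W g * bracket a b g = 2^-1 * ((Pi g)`_2 + (- k%:R) * W g).
  by rewrite Pi2; field.
have nb : nice (fun g => W g * bracket a b g).
  apply: (nice_eq (fun g => esym (bE g))); apply: niceM; first exact: nice_cst.
  by apply: niceD => //; apply: niceM => //; exact: nice_cst.
split=> //; transitivity (expect mu (fun g => 2^-1 * ((Pi g)`_2 + (- k%:R) * W g))).
  by congr (expect mu _); apply/funext.
have nkW : nice (fun g => - k%:R * W g) by apply: niceM => //; exact: nice_cst.
rewrite expectZ; last exact: niceD.
by rewrite expectD// expectZ// e2 mulNr [_ * k%:R]mulrC subrr mulr0.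
Qed.

(** Summing [expect_bracket] over ordered pairs counts each plane twice; half of the sum is the
    Laplacian of [W], and [S] is its quotient by [W]. *)
Lemma expect_trace_bracket :
  let S g := \sum_j (\tr (Z g j) ^+ 2 - \tr (Z g j *m Z g j) - (n%:R - 1) * \tr (Z g j))
    + \sum_j \sum_(i | i != j) (\tr (Z g j *m (Z g i)^T) - \tr (Z g j *m Z g i)) in
  nice (fun g => W g * S g) /\ expect mu (fun g => W g * S g) = 0.
Proof.
move=> S; have SE g : W g * S g =
    2^-1 * \sum_a \sum_b (if b != a then W g * bracket a b g else 0).
  have -> : \sum_a \sum_b (if b != a then W g * bracket a b g else 0) =
      W g * \sum_a \sum_(b | b != a) bracket a b g.
    rewrite mulr_sumr; apply: eq_bigr => a _; by rewrite mulr_sumr [RHS]big_mkcond.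
  rewrite mulrCA; congr (_ * _).
  have -> : \sum_a \sum_(b | b != a) bracket a b g =
    \sum_j \sum_a \sum_(b | b != a) rho a b g j +
    \sum_j \sum_(i | i != j) \sum_a \sum_(b | b != a) kappa a b g j * kappa a b g i.
    have -> : \sum_j \sum_a \sum_(b | b != a) rho a b g j =
        \sum_a \sum_(b | b != a) \sum_j rho a b g j.
      by rewrite exchange_big; apply: eq_bigr => a _; rewrite exchange_big.
    have -> : \sum_j \sum_(i | i != j) \sum_a \sum_(b | b != a)
          kappa a b g j * kappa a b g i =
        \sum_a \sum_(b | b != a) \sum_j \sum_(i | i != j)
          kappa a b g j * kappa a b g i.
      under eq_bigr => j _ do rewrite exchange_big.
      rewrite exchange_big; apply: eq_bigr => a _ /=.
      under eq_bigr => j _ do rewrite exchange_big.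
      by rewrite exchange_big.
    rewrite -big_split; apply: eq_bigr => a _; rewrite -big_split.
    apply: eq_bigr => b _; rewrite /bracket; congr (_ + _).
    rewrite expr2 mulr_suml -sumrB; apply: eq_bigr => j _.
    by rewrite mulr_sumr (bigD1 j)//= expr2 addrAC subrr add0r.
  under eq_bigr => j _ do rewrite sum_plane_minors.
  under [X in _ + X]eq_bigr => j _ do under eq_bigr => i _ do rewrite sum_plane_antisym.
  rewrite -mulr_sumr; under [X in _ + X]eq_bigr => j _ do rewrite -mulr_sumr.
  by rewrite -mulr_sumr -mulrDr mulrA mulVf ?mul1r// pnatr_eq0.
have nb a b : nice (fun g => if b != a then W g * bracket a b g else 0).
  have [_|ba] := eqVneq b a => /=; first exact: nice_cst.
  by have [] := @expect_bracket a b _ ; rewrite 1?eq_sym.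
have ns : nice (fun g => \sum_a \sum_b (if b != a then W g * bracket a b g else 0)).
  by do 2!apply: nice_sum => ?.
split; first by apply: (nice_eq (fun g => esym (SE g))); apply: niceM => //; exact: nice_cst.
transitivity (expect mu (fun g => 2^-1 *
    \sum_a \sum_b (if b != a then W g * bracket a b g else 0))).
  by congr (expect mu _); apply/funext.
rewrite expectZ//.
rewrite expect_sum => [|a]; last exact: nice_sum.
rewrite big1 ?mulr0// => a _; rewrite expect_sum// big1// => b _.
have [_|ba] := eqVneq b a => /=; first exact: expect_cst.
by have [] := @expect_bracket a b _ ; rewrite 1?eq_sym.
Qed.

End Haar.

(** * Expectations of the expansion coefficients *)

Section Moments.
Variables (R : realType) (N k : nat).
Hypotheses (N0 : (0 < N)%N) (k0 : (0 < k)%N).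
Local Notation G := (SO R (2 * N)).

Definition sl_coef (g : G) (a : {ffun 'I_k -> 'I_(N + k)}) : R :=
  dcoef (fcoef N (cpoly g)) a.

Lemma nice_sl_coef a : nice (sl_coef^~ a).
Proof.
apply: nice_det => i j; apply: nice_sum => l; apply: niceM; last exact: nice_cst.
rewrite /fcoef; case: (_ == _); last exact: nice_cpoly_coef.
by apply: niceM; [exact: nice_cpoly_coef | exact: nice_cst].
Qed.

Lemma cpoly_lead (g : G) : fcoef N (cpoly g) N = 1.
Proof.
rewrite /fcoef (gtn_eqF N0) addnn -mul2n; have := char_poly_monic (- mx_of_SO g).
by rewrite monicE lead_coefE size_char_poly => /eqP.
Qed.

Variable mu : probability G R.
Hypothesis hmu : is_haar mu.

Lemma expect_sl_coef a : expect mu (sl_coef^~ a) = 2 * top_det R a.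
Proof.
pose c (a : {ffun 'I_k -> 'I_(N + k)}) : R :=
  (\sum_j (a j) ^ 2)%:R - (\sum_(i < k) (N + i) ^ 2)%:R.
(* [bracket_eq] is integrated at every injective [x] in the unit interval, and [tau_prod_free]
   separates the exponents. *)
have h a' : c a' * expect mu (sl_coef^~ a') = 0.
  move: a'; apply: tau_prod_free; first by rewrite addn_gt0 N0.
  move=> x x01 xI.
  have xn0 : (\prod_j x j) ^+ N != 0.
    by rewrite expf_neq0//; apply/prodf_neq0 => j _; case/andP: (x01 j) => /gt_eqF ->.
  apply: (mulfI xn0); rewrite mulr0.
  transitivity (expect mu (fun g => (\prod_j x j) ^+ N *
    \sum_(a : {ffun 'I_k -> 'I_(N + k)}) (c a * \prod_j tau (a j) (x j)) * sl_coef g a)).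
    rewrite expectZ; last first.
      by apply: nice_sum => a'; apply: niceM; [exact: nice_cst | exact: nice_sl_coef].
    congr (_ * _); rewrite expect_sum => [|a']; last first.
      by apply: niceM; [exact: nice_cst | exact: nice_sl_coef].
    apply: eq_bigr => a' _; rewrite expectZ; last exact: nice_sl_coef.
    by rewrite mulrA (mulrC (c a')).
  have := expect_trace_bracket hmu x01; set S := fun g => _ => -[nS eS].
  transitivity (expect mu (fun g => \det (\matrix_(i < k, j < k) tau i (x j)) *
     (\prod_j (cpoly g).[x j] * S g))); last by rewrite expectZ// eS mulr0.
  congr (expect mu _); apply/funext => g; rewrite [RHS]mulrA [X in _ = X * _]mulrC.
  rewrite (bracket_eq (mx_of_SO_orth g) (mx_of_SO_det g) x01 xI).
  by congr (_ * _); apply: eq_bigr => a' _; rewrite mulrA.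
(* If [c a = 0], the coefficient is the same for all [g]; otherwise [h] makes its expectation
   vanish. *)
have [e|/eqP ne] := eqVneq (\sum_j (a j) ^ 2)%N (\sum_(i < k) (N + i) ^ 2)%N.
  rewrite -[RHS](expect_cst mu); congr (expect mu _); apply/funext => g.
  by apply: dcoef_top => //; exact: cpoly_lead.
rewrite top_det_eq0// mulr0; have /eqP := h a; rewrite mulf_eq0 => /orP[|/eqP //].
by rewrite subr_eq0 eqr_nat => /eqP.
Qed.

End Moments.

(** * Passage to complex arguments *)

Section Complex.
Local Open Scope complex_scope.

Lemma ReM_real (R : rcfType) (z : R[i]) (r : R) :
  complex.Re (z * r%:C) = complex.Re z * r.
Proof. by case: z => a b /=; rewrite mulr0 subr0. Qed.

Lemma ImM_real (R : rcfType) (z : R[i]) (r : R) :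
  complex.Im (z * r%:C) = complex.Im z * r.
Proof. by case: z => a b /=; rewrite mulr0 add0r. Qed.

Lemma Re_sum (R : rcfType) (I : finType) (F : I -> R[i]) :
  complex.Re (\sum_i F i) = \sum_i complex.Re (F i).
Proof. by apply: (big_morph _ _ (erefl _)) => -[? ?] [? ?]. Qed.

Lemma Im_sum (R : rcfType) (I : finType) (F : I -> R[i]) :
  complex.Im (\sum_i F i) = \sum_i complex.Im (F i).
Proof. by apply: (big_morph _ _ (erefl _)) => -[? ?] [? ?]. Qed.

Lemma cexpectation_sum (R : realType) (n : nat) (mu : probability (SO R n) R)
    (I : finType) (z : I -> R[i]) (d : I -> SO R n -> R) :
    (forall i, nice (d i)) ->
  cexpectation mu (fun g => \sum_i z i * (d i g)%:C) =
  \sum_i z i * (expect mu (d i))%:C.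
Proof.
move=> nd; have ndZ c i : nice (fun g => c * d i g).
  by apply: niceM => //; exact: nice_cst.
have eZ (c : I -> R) : expect mu (fun g => \sum_i c i * d i g) =
    \sum_i c i * expect mu (d i).
  by rewrite expect_sum => [|i //]; apply: eq_bigr => i _; rewrite expectZ.
transitivity ((\sum_i complex.Re (z i) * expect mu (d i)) +i*
    (\sum_i complex.Im (z i) * expect mu (d i))).
  rewrite -!eZ /cexpectation; congr (_ +i* _); congr (expect mu _); apply/funext => g.
    by rewrite Re_sum; apply: eq_bigr => i _; rewrite ReM_real.
  by rewrite Im_sum; apply: eq_bigr => i _; rewrite ImM_real.
apply/eqP; rewrite eq_complex Re_sum Im_sum; apply/andP; split; apply/eqP.
  by apply: eq_bigr => i _; rewrite ReM_real.
by apply: eq_bigr => i _; rewrite ImM_real.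
Qed.

Lemma det_SO_cmx (R : realType) (n : nat) (g : SO R n) (z : R[i]) :
  \det (1%:M + z *: SO_cmx g) = (map_poly (real_complex R) (cpoly g)).[z].
Proof.
have gg : (SO_cmx g)^T *m SO_cmx g = 1%:M.
  rewrite -(map_mx1 (real_complex R)) -(mx_of_SO_orth g) map_mxM.
  by congr (_ *m _); apply/matrixP => i j; rewrite !mxE.
have dg : \det (SO_cmx g) = 1 by rewrite det_map_mx mx_of_SO_det rmorph1.
rewrite det_1_addZ// -horner_char_polyN map_char_poly; congr (char_poly _).[_].
by rewrite map_mxN.
Qed.

Lemma fcoef_map (R : realType) (N l : nat) (p : {poly R}) :
  fcoef N (map_poly (real_complex R) p) l = (fcoef N p l)%:C.
Proof.
rewrite /fcoef !coef_map; case: (_ == _) => //.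
by rewrite rmorphM fmorphV rmorph_nat.
Qed.

Lemma dcoef_map (R : realType) (N k : nat) (f : nat -> R)
    (a : {ffun 'I_k -> 'I_(N + k)}) :
  dcoef (fun l => (f l)%:C) a = (dcoef f a)%:C.
Proof.
rewrite /dcoef -det_map_mx; congr (\det _); apply/matrixP => i j.
rewrite !mxE rmorph_sum; apply: eq_bigr => l _.
by rewrite rmorphM rmorphD !rmorph_nat.
Qed.

Lemma top_det_map (R : realType) (N k : nat) (a : {ffun 'I_k -> 'I_(N + k)}) :
  (top_det R a)%:C = top_det R[i] a.
Proof.
rewrite /top_det -det_map_mx; congr (\det _); apply/matrixP => i j.
by rewrite !mxE rmorph_nat.
Qed.

(** The rows of the alternants come in reverse order; the sign of the reversal cancels in the
    quotient. *)
Lemma chiO_tau (F : numFieldType) (N k : nat) (x : 'I_k -> F) :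
  chiO (rect_part N k) x =
  2 * \det (\matrix_(i < k, j < k) tau (N + i) (x j)) /
    \det (\matrix_(i < k, j < k) tau i (x j)).
Proof.
pose s := perm (@rev_ord_inj k).
have E (m : nat) (la : seq nat) : (forall i : 'I_k, nth 0%N la i = m) ->
    chiO_alternant la x =
    (-1) ^+ s * \det (\matrix_(i < k, j < k) tau (m + i) (x j)).
  move=> h; rewrite -det_perm -det_mulmx -row_permE; congr (\det _).
  by apply/matrixP => i j; rewrite !mxE h permE.
rewrite /chiO (E N) => [|i]; last by rewrite nth_nseq ltn_ord.
rewrite (E 0%N) => [|i]; last by rewrite nth_nil.
by rewrite mulrCA -mulf_div divff ?mul1r// signr_eq0.
Qed.

(** The coefficients [sl_coef] are real and do not involve [x], so their expectations, found from
    real [x], serve at complex [x]; [sum_top_det] resums the expansion. *)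
Lemma cexpectation_det (R : realType) (N k : nat) (mu : probability (SO R (2 * N)) R)
    (x : 'I_k -> R[i]) : (0 < N)%N -> (0 < k)%N -> is_haar mu ->
    (forall j, x j != 0) ->
    (forall i j : 'I_k, (i < j)%N -> x i != x j /\ x i * x j != 1) ->
  cexpectation mu (fun g => \prod_(j < k) \det (1%:M + x j *: SO_cmx g)) =
  (\prod_(j < k) x j) ^+ N *
    (2 * \det (\matrix_(i < k, j < k) tau (N + i) (x j)) /
       \det (\matrix_(i < k, j < k) tau i (x j))).
Proof.
move=> N0 k0 hmu x0 hx; set V := \det (\matrix_(i, j) tau i (x j)).
have V0 : V != 0 by rewrite /V det_tau// mulf_neq0 ?pnatr_eq0// prod_addV_neq0.
pose z (a : {ffun 'I_k -> 'I_(N + k)}) : R[i] :=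
  (\prod_j x j) ^+ N / V * \prod_j tau (a j) (x j).
transitivity (cexpectation mu (fun g => \sum_a z a * (sl_coef g a)%:C)).
  congr (cexpectation mu _); apply/funext => g.
  rewrite (eq_bigr _ (fun j _ => det_SO_cmx g (x j))).
  set p := map_poly _ _.
  have hp j : p.[x j] = x j ^+ N * \sum_(l < N.+1) fcoef N p l * tau l (x j).
    rewrite -horner_cheb_sum//; apply: horner_palindrome => // [|i le_i].
      by rewrite size_map_poly size_char_poly.
    rewrite !coef_map; congr (_%:C).
    exact: (char_polyN_rev (mx_of_SO_orth g) (mx_of_SO_det g)).
  rewrite (eq_bigr _ (fun j _ => hp j)) big_split /= prodrXl.
  apply: (mulIf V0).
  rewrite -mulrA slater_expand// mulr_suml mulr_sumr; apply: eq_bigr => a _.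
  rewrite /z -dcoef_map.
  have -> : dcoef (fcoef N p) a = dcoef (fun l => (fcoef N (cpoly g) l)%:C) a.
    by congr dcoef; apply/funext => l; rewrite fcoef_map.
  by field.
rewrite cexpectation_sum => [|a]; last exact: nice_sl_coef.
rewrite -sum_top_det !mulr_sumr mulr_suml mulr_sumr; apply: eq_bigr => a _.
rewrite expect_sl_coef// rmorphM rmorph_nat /= top_det_map /z; by field.
Qed.

End Complex.

Theorem proposition13 (R : realType) (N k : nat) (hN : (1 <= N)%N)
    (hk : (1 <= k)%N) (mu : probability (SO R (2 * N)) R) (hmu : is_haar mu)
    (x : 'I_k -> R[i]) (hx0 : forall j : 'I_k, x j != 0)
    (hx : forall i j : 'I_k, (i < j)%N -> x i != x j /\ x i * x j != 1) :
  cexpectation mu (fun g => \prod_(j < k) \det (1%:M + x j *: SO_cmx g))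
    = (\prod_(j < k) x j) ^+ N * chiO (rect_part N k) x
  /\
  (\prod_(j < k) x j) ^+ N * chiO (rect_part N k) x
    = \sum_(e : {ffun 'I_k -> bool})
        (\prod_(j < k) x j ^ (N%:Z * (1 - sgn_of e j)))
        * \prod_(i < k) \prod_(j < k | (i < j)%N)
            (1 - x i ^ (sgn_of e i) * x j ^ (sgn_of e j))^-1.
Proof.
rewrite chiO_tau; split; first exact: cexpectation_det.
by rewrite -sign_sum.
Qed.
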